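(* Let $(G_n)_{n\ge 1}$ be a sequence of finite groups with $|G_n|\to\infty$. For every fixed integer $m\ge 3$, the following four conditions are equivalent (so all of them, for all $m\geq 3$, are equivalent to one another): 1. For every constant $k$, for all sufficiently large $n$, $G_n$ contains no non-trivial conjugacy class of size at most $k$. 2. For every constant $\delta>0$, for all sufficiently large $n$: if $V_1,V_2,V_3$ are $G_n$-representations with $M_{G_n}(V_i)\ge\delta$ for $i=1,2,3$, then $V_1\otimes V_2\otimes V_3$ contains every irreducible $G_n$-representation as a subrepresentation. 3. For every constant $\delta>0$, for all sufficiently large $n$: if $V$ is a $G_n$-representation with $M_{G_n}(V)\ge\delta$, then $M_{G_n}(V^{\otimes m})>\frac12$. 4. For every constant $k$, for all sufficiently large $n$, $G_n$ contains neither a non-trivial normal subgroup of size at most $k$, nor a normal subgroup of index at most $k$ (possibly equal to $G_n$) with non-trivial center.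
   Context: All representations are finite-dimensional and over $\mathbb C$. $\mathrm{Irrep}(G)$ is the set of isomorphism classes of irreducible representations of the finite group $G$. The Plancherel measure is the probability distribution $M_G$ on $\mathrm{Irrep}(G)$ given by $M_G(\lambda)=\frac{\dim(\lambda)^2}{|G|}$. For an arbitrary finite-dimensional $G$-representation $V$, $M_G(V)$ denotes the Plancherel measure of the set of isomorphism classes of irreducible subrepresentations of $V$, i.e. $M_G(V)=\sum_{\lambda\in\mathrm{Irrep}(G),\,\lambda\subseteq V}\frac{\dim(\lambda)^2}{|G|}$. A conjugacy class is non-trivial if it is not $\{e\}$ (so the class of a central element $g\neq e$ is a non-trivial class of size $1$). A subgroup is non-trivial if it is not $\{e\}$. *)

(* Defs.v *)
From HB Require Import structures.
From mathcomp Require Import all_boot all_order all_fingroup all_algebra.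
From mathcomp Require Import all_solvable all_field all_character.
From mathcomp Require Import boolp classical_sets filter reals complex.

Set Implicit Arguments.
Unset Strict Implicit.
Unset Printing Implicit Defensive.

Import Order.TTheory GRing.Theory Num.Theory.
Local Open Scope classical_set_scope.
Local Open Scope ring_scope.
Local Open Scope complex_scope.

Section Plancherel.

Variables (R : realType) (gT : finGroupType) (G : {group gT}).

Definition subrep (W V : representation R[i] G) : Prop :=
  exists (U : 'M[R[i]]_(rdegree V)) (modU : mxmodule V U),
    mx_rsim W (submod_repr modU).

(* Irr indexes the isomorphism classes of irreducible representations through
   the components of the regular representation; Irr_complete and Irr_inj
   below show that each class is counted exactly once. *)
Definition Irr : irrType R[i] G := DecSocleType (regular_repr R[i] G).

Definition irrep (l : Irr) : representation R[i] G :=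
  Representation (irr_repr l).

Definition plancherel (V : representation R[i] G) : R :=
  \sum_(l : Irr | `[< subrep (irrep l) V >])
     (rdegree (irrep l))%:R ^+ 2 / #|G|%:R.

Definition tensor (V W : representation R[i] G) : representation R[i] G :=
  Representation (prod_repr V W).

Fact triv_mx_repr : mx_repr G (fun _ : gT => 1%:M : 'M[R[i]]_1).
Proof. by split=> // x y _ _; rewrite mulmx1. Qed.

Definition triv_rep : representation R[i] G :=
  Representation (MxRepresentation triv_mx_repr).

(* V (x) (V (x) ... (x) V) with m factors; triv_rep is used only for m = 0. *)
Definition tensor_exp (V : representation R[i] G) (m : nat) :
    representation R[i] G :=
  iterop m tensor V triv_rep.

Let charG : ([pchar R[i]]^'.-group G)%g.
Proof. by apply/pgroupP => p _ _; rewrite inE /= pchar_num. Qed.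

Lemma Irr_irreducible (l : Irr) : mx_irreducible (irrep l).
Proof. exact: socle_irr. Qed.

Lemma Irr_complete (W : representation R[i] G) :
  mx_irreducible W -> exists l : Irr, mx_rsim W (irrep l).
Proof. by exists (irr_comp Irr W); apply: rsim_irr_comp_pchar. Qed.

Lemma Irr_inj (l1 l2 : Irr) : mx_rsim (irrep l1) (irrep l2) -> l1 = l2.
Proof.
move=> sim12; rewrite -(irr_reprK_pchar charG l1) -(irr_reprK_pchar charG l2).
exact: irr_comp_rsim_pchar sim12.
Qed.

Lemma plancherel_total :
  \sum_(l : Irr) (rdegree (irrep l))%:R ^+ 2 / #|G|%:R = 1 :> R.
Proof.
have sumG := sum_irr_degree_pchar Irr charG (@group_closure_closed_field _ _ G).
have -> : #|G|%:R = \sum_(l : Irr) (rdegree (irrep l))%:R ^+ 2 :> R.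
  by rewrite -sumG natr_sum; apply: eq_bigr => l _; rewrite natrX.
rewrite -mulr_suml divff //.
under eq_bigr do rewrite -natrX.
by rewrite -natr_sum sumG pnatr_eq0 -lt0n.
Qed.

End Plancherel.

(* Main.v *)
(** For a set S of irreducible characters let f_S be the sum over S of
   [dim(l) * chi_l]; then f_S(1) = |G| M(S), and Parseval bounds the sum of
   [|f_S|^2] by |G|^2. As f_S is constant on classes, |f_S(g)| is at most
   |G| / sqrt k when the class of g has size at least k. So if all nontrivial
   classes are large, the inner product of f_S1 f_S2 f_S3 with any irreducible
   character is dominated by its term at g = 1, hence nonzero: 1 implies 2.
   Tensoring a representation that contains every irreducible by a nonzero one
   keeps this property (pair with the regular character), so 2 implies 3.

   If 4 fails, there is z <> 1 whose class K is small and either generates a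
   bounded group or lies in an abelian normal subgroup, so the lazy random walk
   with steps in K visits only polynomially many elements in time t. Its return
   probability is then not exponentially small; by Plancherel inversion the set S
   of the l such that omega_l = chi_l(z) / dim(l) is close to 1 has measure
   bounded below. For those l all eigenvalues of z are close to 1, a property
   inherited by constituents of tensor powers. On the other hand the mean of
   omega is 0 and that of omega^2 is 0 or 1/|K|, which forces the measure of the
   set where Re omega >= 19/20 to be at most 1/2. So 3 implies 4.

   Finally, let K be a small class, H the subgroup it generates and C the
   centralizer of K. Either H and C meet trivially, and then |H| <= |G : C| is
   bounded, or the center of C is nontrivial: 4 implies 1. *)

Require Import Defs.
From HB Require Import structures.
From mathcomp Require Import all_boot all_order all_fingroup all_algebra.
From mathcomp Require Import all_solvable all_field all_character.
From mathcomp Require Import boolp classical_sets filter reals complex.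
From mathcomp Require Import ring.

Set Implicit Arguments.
Unset Strict Implicit.
Unset Printing Implicit Defensive.

Import Order.TTheory GRing.Theory Num.Theory.
Local Open Scope classical_set_scope.
Local Open Scope ring_scope.

(** * Characters of complex representations *)

Section Characters.

Variables (C : numClosedFieldType) (gT : finGroupType) (G : {group gT}).
Implicit Types (V W : representation C G) (g x : gT).

Definition chi V g : C := \tr (V g).

Lemma chi1 V : chi V 1%g = (rdegree V)%:R.
Proof. by rewrite /chi repr_mx1 mxtrace1. Qed.

Lemma chi_prod V W g : chi (Representation (prod_repr V W)) g = chi V g * chi W g.
Proof. exact: mxtrace_prod. Qed.

Lemma chi_dadd V W g : chi (dadd_grepr V W) g = chi V g + chi W g.
Proof. exact: mxtrace_block. Qed.

Lemma chiJ V g x : g \in G -> x \in G -> chi V (g ^ x) = chi V g.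
Proof.
by move=> Gg Gx; rewrite /chi !repr_mxM ?groupM ?groupV // mxtrace_mulC repr_mxK.
Qed.

(** The minimal polynomial divides ['X^N - 1], which is separable in characteristic 0. *)
Lemma diagonalizable_unipow n (A : 'M[C]_n.+1) (N : nat) :
  (0 < N)%N -> A ^+ N = 1 -> diagonalizable A.
Proof.
move=> N_gt0 AN; apply/diagonalizableP.
have [rs Ers] := closed_field_poly_normal ('X^N - 1 : {poly C}).
have lc1 : lead_coef ('X^N - 1 : {poly C}) = 1.
  by rewrite -[1 in LHS]polyC1 lead_coefDl ?lead_coefXn // size_polyXn size_polyN
             size_polyC oner_eq0.
rewrite lc1 scale1r in Ers; exists rs; rewrite -?Ers.
  by rewrite -separable_prod_XsubC -Ers separable_Xn_sub_1 // pnatr_eq0 -lt0n.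
apply: mxminpoly_min.
by rewrite rmorphB rmorphXn rmorph1 /= horner_mx_X AN subrr.
Qed.

(** One change of basis diagonalizes all powers of [g], so a single list of eigenvalues gives the
    character of each power as a power sum. *)
Lemma repr_spectrum V g : g \in G -> exists s : seq C,
  [/\ size s = rdegree V, {in s, forall a, a ^+ #[g]%g = 1},
      {in s, forall a, eigenvalue (V g) a}
    & forall j, chi V (g ^+ j)%g = \sum_(a <- s) a ^+ j].
Proof.
case: V => n V Gg; rewrite /chi /=; case: n => [|n] in V *.
  exists [::]; split=> // j; rewrite big_nil /mxtrace big_ord0 //.
have VX j : V (g ^+ j)%g = V g ^+ j by rewrite repr_mxX.
have [P uP /(diagonalizable_forLR uP)[d Ed]] : diagonalizable (V g).
  by apply: (@diagonalizable_unipow _ _ #[g]%g) => //; rewrite -VX expg_order repr_mx1.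
rewrite mxpoly.conjVmx // in Ed.
have VXd j : V g ^+ j = invmx P *m (diag_mx d ^+ j) *m P.
  elim: j => [|j IHj]; first by rewrite !expr0 mulmx1 mulVmx.
  by rewrite !exprS -!mulmxE IHj Ed !mulmxA mulmxK.
have dX j : diag_mx d ^+ j = diag_mx (\row_i d 0 i ^+ j).
  elim: j => [|j IHj].
    by apply/matrixP=> i k; rewrite expr0 !mxE expr0.
  rewrite exprS -mulmxE IHj mulmx_diag; congr diag_mx.
  by apply/rowP=> i; rewrite !mxE exprS.
exists [seq d 0 i | i <- enum 'I_n.+1]; split.
- by rewrite size_map size_enum_ord.
- move=> _ /mapP[i _ ->].
  have /(congr1 (fun A => P *m A *m invmx P)) := VXd #[g]%g.
  rewrite -VX expg_order repr_mx1 mulmx1 mulmxV // !mulmxA mulmxV // mul1mx mulmxK //.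
  by move/matrixP/(_ i i); rewrite dX !mxE !eqxx !mulr1n => <-.
- move=> _ /mapP[i _ ->]; apply/eigenvalueP; exists (row i P).
    by rewrite Ed rowE !mulmxA mulmxK // -(rowE i (diag_mx d)) row_diag_mx scalemxAl.
  apply: contraTneq uP => Pi0; rewrite -row_free_unit -kermx_eq0.
  apply/rowV0Pn; exists (delta_mx 0 i).
    by apply/sub_kermxP; rewrite -rowE Pi0.
  by apply/eqP => /rowP/(_ i); rewrite !mxE !eqxx => /eqP; rewrite oner_eq0.
- move=> j; rewrite VX VXd -mulmxA mxtrace_mulC -mulmxA mulmxV // mulmx1 dX.
  rewrite mxtrace_diag big_map big_enum /=.
  by apply: eq_bigr => i _; rewrite mxE.
Qed.

Lemma unity_norm (a : C) N : (0 < N)%N -> a ^+ N = 1 -> `|a| = 1.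
Proof.
by move=> N_gt0 aN; apply/eqP; rewrite -(@pexpr_eq1 _ _ N) // -normrX aN normr1.
Qed.

Lemma chi_norm V g : g \in G -> `|chi V g| <= (rdegree V)%:R.
Proof.
move=> Gg; have [s [sV s1 _ /(_ 1%N)]] := repr_spectrum V Gg.
rewrite expg1 => ->; apply: le_trans (ler_norm_sum _ _ _) _.
rewrite -sV -sum1_size natr_sum big_seq [leRHS]big_seq ler_sum // => a sa.
by rewrite expr1 (unity_norm _ (s1 a sa)).
Qed.

(** The eigenvalues are roots of unity, whose inverses are their conjugates. *)
Lemma chiV V g : g \in G -> chi V g^-1%g = Num.conj (chi V g).
Proof.
move=> Gg; have [s [_ s1 _ sE]] := repr_spectrum V Gg.
rewrite invg_expg sE -[in RHS](expg1 g) sE rmorph_sum /=.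
rewrite big_seq [RHS]big_seq; apply: eq_bigr => a sa; rewrite expr1.
have a1 := unity_norm (order_gt0 g) (s1 a sa).
have a0 : a != 0 by rewrite -normr_eq0 a1 oner_eq0.
apply: (mulfI a0); rewrite -exprS prednK // s1 //.
by rewrite -normCK a1 expr1n.
Qed.

End Characters.

(** * Schur's lemma and the orthogonality of characters *)

Section Irreducibles.

Variables (C : numClosedFieldType) (gT : finGroupType) (G : {group gT}).
Implicit Types (V W : representation C G) (g x : gT).

Local Notation Irr := (DecSocleType (regular_repr C G)).

(** Schur's lemma: the kernel and the image of [B] are submodules, so irreducibility makes the
    kernel zero and the image everything. *)
Lemma mx_rsim_intertwiner V W (B : 'M_(rdegree V, rdegree W)) :
    mx_irreducible V -> mx_irreducible W ->
    {in G, forall g, V g *m B = B *m W g} -> B != 0 ->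
  mx_rsim V W.
Proof.
move=> /mx_irrP[_ irrV] /mx_irrP[_ irrW] homB nzB.
have freeB : row_free B.
  rewrite -kermx_eq0; apply: contraR nzB => nzK.
  have: row_full (kermx B).
    apply: irrV nzK; apply/mxmoduleP=> g Gg; apply/sub_kermxP.
    by rewrite -mulmxA homB // mulmxA mulmx_ker mul0mx.
  by rewrite -sub1mx => /sub_kermxP; rewrite mul1mx => ->.
have fullB : row_full <<B>>%MS.
  apply: irrW; last by rewrite -mxrank_eq0 genmxE mxrank_eq0.
  rewrite (eqmx_module _ (genmxE B)).
  by apply/mxmoduleP=> g Gg; rewrite -homB // submxMl.
have eqn : rdegree V = rdegree W.
  by move/eqP: fullB; rewrite genmxE (eqP freeB).
exact: MxReprSim eqn freeB homB.
Qed.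

Lemma pchar_group : ([pchar C]^'.-group G)%g.
Proof. by apply/pgroupP => p _ _; rewrite inE /= pchar_num. Qed.

Lemma cent_irr_scalar V (A : 'M_(rdegree V)) :
  mx_irreducible V -> centgmx V A -> exists c, A = c%:M.
Proof.
move=> irrV cVA; apply/is_scalar_mxP.
exact: mx_abs_irr_cent_scalar (group_closure_closed_field irrV) _ cVA.
Qed.

(** The projection onto intertwiners, up to the factor [#|G|]. Its values on elementary matrices add
    up to the inner product of characters ([chi_mul_avg]). *)
Let avg V W (X : 'M_(rdegree V, rdegree W)) :=
  \sum_(g in G) V g^-1%g *m X *m W g.

Let avg_hom V W X : {in G, forall x, V x *m @avg V W X = @avg V W X *m W x}.
Proof.
move=> x Gx; rewrite /avg mulmx_sumr mulmx_suml.
rewrite (reindex_inj (mulIg x)) /=; apply: eq_big => [g|g].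
  by rewrite groupMr.
rewrite groupMr // => Gg.
by rewrite invMg !repr_mxM ?groupV // !mulmxA -repr_mxM ?groupV // mulgV repr_mx1 mul1mx.
Qed.

Let chi_mul_avg V W :
  \sum_(g in G) chi V g^-1%g * chi W g =
  \sum_i \sum_j @avg V W (delta_mx i j) i j.
Proof.
pose E g i j := (V g^-1%g *m delta_mx i j *m W g) i j.
transitivity (\sum_i \sum_j \sum_(g in G) E g i j); last first.
  by apply: eq_bigr => i _; apply: eq_bigr => j _; rewrite summxE.
under [RHS]eq_bigr => i _ do rewrite exchange_big /=.
rewrite exchange_big /=; apply: eq_bigr => g Gg.
rewrite /chi /mxtrace mulr_suml; apply: eq_bigr => i _.
rewrite mulr_sumr; apply: eq_bigr => j _.
rewrite /E mxE (bigD1 j) //= big1 => [|k kj]; last first.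
  rewrite mxE big1 ?mul0r // => k' _.
  by rewrite mxE (negPf kj) andbF mulr0.
rewrite addr0; congr (_ * _).
rewrite mxE (bigD1 i) //= big1 => [|k ki]; last first.
  by rewrite mxE (negPf ki) mulr0.
by rewrite mxE !eqxx mulr1 addr0.
Qed.

Lemma chi_orthogonal V W : mx_irreducible V -> mx_irreducible W ->
  ~ mx_rsim V W -> \sum_(g in G) chi V g * Num.conj (chi W g) = 0.
Proof.
move=> irrV irrW nsimVW.
under eq_bigr => g Gg do rewrite -chiV // mulrC.
rewrite chi_mul_avg big1 // => i _; rewrite big1 // => j _.
have [->|nz] := eqVneq (@avg W V (delta_mx i j)) 0; first by rewrite mxE.
case: nsimVW; apply: mx_rsim_sym.
exact: mx_rsim_intertwiner irrW irrV (@avg_hom _ _ _) nz.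
Qed.

Lemma chi_norm1 V : mx_irreducible V ->
  \sum_(g in G) chi V g * Num.conj (chi V g) = #|G|%:R.
Proof.
move=> irrV; under eq_bigr => g Gg do rewrite -chiV // mulrC.
have V_gt0 : (0 < rdegree V)%N by case/mx_irrP: irrV.
have d0 : (rdegree V)%:R != 0 :> C by rewrite pnatr_eq0 -lt0n.
(* The average is a scalar matrix by Schur's lemma, and the scalar is read off from the trace. *)
have avgE i j : @avg V V (delta_mx i j) i j = #|G|%:R / (rdegree V)%:R *+ (i == j).
  have [c Ec] : exists c, @avg V V (delta_mx i j) = c%:M.
    apply: (cent_irr_scalar irrV); apply/centgmxP=> x Gx.
    by rewrite avg_hom.
  have: \tr (@avg V V (delta_mx i j)) = #|G|%:R *+ (i == j).
    rewrite /avg raddf_sum /= -sumr_const -sumrMnl.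
    apply: eq_bigr => g Gg; rewrite -mulmxA mxtrace_mulC -mulmxA.
    rewrite -repr_mxM ?groupV // mulgV repr_mx1 mulmx1 /mxtrace (bigD1 i) //=.
    rewrite big1 => [|k ki]; first by rewrite mxE eqxx addr0.
    by rewrite mxE (negPf ki).
  rewrite Ec mxtrace_scalar mxE => tr_c.
  have [eqij | neqij] := eqVneq i j; last by [].
  rewrite eqij eqxx !mulr1n in tr_c *.
  by rewrite -tr_c -[c *+ _]mulr_natr mulfK.
rewrite chi_mul_avg; under eq_bigr => i _.
  under eq_bigr => j _ do rewrite avgE.
  rewrite (bigD1 i) //= eqxx big1 => [|j ji]; last by rewrite eq_sym (negPf ji).
  rewrite addr0 mulr1n; over.
by rewrite sumr_const card_ord -[_ *+ rdegree V]mulr_natr divfK.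
Qed.

End Irreducibles.

(** * Multiplicities and central characters *)

Section Multiplicities.

Variables (C : numClosedFieldType) (gT : finGroupType) (G : {group gT}).
Implicit Types (V W : representation C G) (g x : gT).

Local Notation Irr := (DecSocleType (regular_repr C G)).
Implicit Types l : Irr.

Definition irr_rep l : representation C G := Representation (irr_repr l).

Definition xi l g : C := chi (irr_rep l) g.

Definition is_subrep W V : Prop :=
  exists (U : 'M[C]_(rdegree V)) (modU : mxmodule V U),
    mx_rsim W (submod_repr modU).

Lemma irr_rep_irr l : mx_irreducible (irr_rep l).
Proof. exact: socle_irr. Qed.

Lemma xi_norm l g : g \in G -> `|xi l g| <= (irr_degree l)%:R.
Proof. exact: (@chi_norm _ _ _ (irr_rep l)). Qed.

Lemma xi_orthogonal l1 l2 :
  \sum_(g in G) xi l1 g * Num.conj (xi l2 g) = #|G|%:R *+ (l1 == l2).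
Proof.
have [->|neq12] := eqVneq l1 l2; first by rewrite chi_norm1 //; apply: irr_rep_irr.
rewrite chi_orthogonal //; try exact: irr_rep_irr.
move=> sim12; case/eqP: neq12.
rewrite -(irr_reprK_pchar (pchar_group C G) l1) -(irr_reprK_pchar (pchar_group C G) l2).
exact: (irr_comp_rsim_pchar _ (pchar_group C G) sim12).
Qed.

Lemma chi_decomposition V : exists m : Irr -> nat,
  [/\ {in G, forall g, chi V g = \sum_l (m l)%:R * xi l g}
    & forall l, (0 < m l)%N -> is_subrep (irr_rep l) V].
Proof.
(* By Maschke [V] is its own socle. Each homogeneous component of [V] is matched with one of the
   regular representation, and [m] collects those sent to [l]. *)
pose sV : socleType V := DecSocleType V.
pose comp (W : sV) := irr_comp (DecSocleType (regular_repr C G)) (socle_repr W).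
pose m l := (\sum_(W | comp W == l) socle_mult W)%N.
have simW (W : sV) : mx_rsim (socle_repr W) (irr_repr (comp W)).
  apply: rsim_irr_comp_pchar; [exact: pchar_group | exact: socle_irr].
exists m; split=> [g Gg | l].
  have V1 : (Socle sV :=: 1%:M)%MS.
    have := reducible_Socle1 sV (mx_Maschke_pchar _ (pchar_group C G)).
    by move=> ->.
  rewrite /chi -(mxtrace_submod1 (Socle_module sV) V1) // mxtrace_Socle //.
  rewrite (partition_big comp xpredT) //=; apply: eq_bigr => l _.
  rewrite natr_sum mulr_suml; apply: eq_bigr => W /eqP <-.
  rewrite mulr_natl; congr (_ *+ _).
  exact: mxtrace_rsim (simW W) _ Gg.
rewrite lt0n sum_nat_eq0 negb_forall => /existsP[W].
rewrite negb_imply => /andP[/eqP Wl _].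
exists (socle_base W), (socle_module W).
by rewrite -Wl; apply: mx_rsim_sym; apply: simW.
Qed.

(** The choice is harmless: [mult_dot] recovers the chosen value from the character. *)
Definition mult V : Irr -> nat := sval (cid (chi_decomposition V)).

Lemma chi_mult V : {in G, forall g, chi V g = \sum_l (mult V l)%:R * xi l g}.
Proof. by rewrite /mult; case: cid => m /= []. Qed.

Lemma mult_dot V l :
  \sum_(g in G) chi V g * Num.conj (xi l g) = (mult V l)%:R * #|G|%:R.
Proof.
under eq_bigr => g Gg do rewrite chi_mult // mulr_suml.
rewrite exchange_big /= (bigD1 l) //= [X in _ + X]big1 => [|l' ll'].
  by under eq_bigr do rewrite -mulrA; rewrite -mulr_sumr xi_orthogonal eqxx addr0.
under eq_bigr do rewrite -mulrA.
by rewrite -mulr_sumr xi_orthogonal (negPf ll') mulr0.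
Qed.

Lemma chi_is_subrep W V : is_subrep W V ->
  exists V', {in G, forall g, chi V g = chi W g + chi V' g}.
Proof.
move=> [U [modU simU]].
have [U' modU' defV dxV] := mx_Maschke_pchar V (pchar_group C G) modU (submx1 _).
exists (Representation (submod_repr modU')) => g Gg.
rewrite [chi W g](mxtrace_rsim simU Gg) /chi /=.
rewrite (mxtrace_dadd_mod modU modU' (mxmodule1 V) defV dxV Gg).
by rewrite mxtrace_submod1.
Qed.

(** For the converse, a Maschke complement [V'] of the copy of [l] gives
    [mult V l = 1 + mult V' l]. *)
Lemma mult_gt0 V l : (0 < mult V l)%N <-> is_subrep (irr_rep l) V.
Proof.
split; first by rewrite /mult; case: cid => m /= [_ H]; apply: H.
case/chi_is_subrep=> V' EV.
have G0 : #|G|%:R != 0 :> C by rewrite pnatr_eq0 -lt0n.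
suff -> : mult V l = (1 + mult V' l)%N by [].
apply/eqP; rewrite -(eqr_nat C); apply/eqP/(mulIf G0).
rewrite -mult_dot; under eq_bigr => g Gg do rewrite EV // mulrDl.
by rewrite big_split /= xi_orthogonal mult_dot eqxx natrD mulrDl mul1r.
Qed.

Lemma mult_eq V W : {in G, chi V =1 chi W} -> mult V =1 mult W.
Proof.
move=> eqVW l; have G0 : #|G|%:R != 0 :> C by rewrite pnatr_eq0 -lt0n.
apply/eqP; rewrite -(eqr_nat C); apply/eqP/(mulIf G0).
by rewrite -!mult_dot; apply: eq_bigr => g Gg; rewrite eqVW.
Qed.

Lemma xi_regular g : g \in G ->
  \sum_l (irr_degree l)%:R * xi l g = #|G|%:R *+ (g == 1%g).
Proof.
move=> Gg; have splitG : group_splitting_field C G by apply: group_closure_closed_field.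
have := mxtrace_regular_pchar (DecSocleType (regular_repr C G)) (pchar_group C G) splitG Gg.
under [in X in _ = X -> _]eq_bigr do rewrite -mulr_natl.
rewrite /xi /chi => <-; have [->|nt_g] := eqVneq g 1%g.
  by rewrite repr_mx1 mxtrace1.
rewrite [\tr _]big1 // => i _; rewrite 2!mxE /= -(inj_eq enum_val_inj).
by rewrite gring_indexK ?groupM ?enum_valP // eq_mulVg1 mulKg (negbTE nt_g).
Qed.

Lemma xi1 l : xi l 1%g = (irr_degree l)%:R.
Proof. exact: chi1. Qed.

Lemma irr_degree_neq0 l : (irr_degree l)%:R != 0 :> C.
Proof. by rewrite pnatr_eq0 -lt0n irr_degree_gt0. Qed.

(** The central character: the scalar by which the average over the class of [z] acts on [l]. *)
Definition omega l z : C := xi l z / (irr_degree l)%:R.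

Lemma omega_norm l z : z \in G -> `|omega l z| <= 1.
Proof.
move=> Gz; rewrite normf_div normr_nat ler_pdivrMr ?ltr0n ?irr_degree_gt0 // mul1r.
exact: xi_norm.
Qed.

Lemma omegaK l z : (irr_degree l)%:R * omega l z = xi l z.
Proof. by rewrite mulrC divfK ?irr_degree_neq0. Qed.

(** The class sum commutes with [G], so Schur's lemma applies; comparing traces gives the scalar. *)
Lemma class_sum_scalar l z : z \in G ->
  \sum_(x in (z ^: G)%g) irr_rep l x = (#|(z ^: G)%g|%:R * omega l z)%:M.
Proof.
move=> Gz; have [|c Ec] := @cent_irr_scalar _ _ _ (irr_rep l)
    (\sum_(x in (z ^: G)%g) irr_rep l x) (irr_rep_irr l).
  apply/centgmxP=> h Gh; rewrite mulmx_suml mulmx_sumr.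
  rewrite [RHS](reindex_inj (conjg_inj h)) /=.
  apply: eq_big => x; first by rewrite memJ_norm // (fintype.subsetP (class_norm z G)).
  move=> Kx; have Gx : x \in G by case/imsetP: Kx => y Gy ->; rewrite groupJ.
  by rewrite -!repr_mxM ?groupJ // -conjgC.
rewrite Ec; congr _%:M; apply: (mulIf (irr_degree_neq0 l)).
rewrite mulrAC -mulrA omegaK mulr_natr -mxtrace_scalar -Ec raddf_sum /=.
rewrite mulr_natl -sumr_const; apply: eq_bigr => _ /imsetP[h Gh ->].
by rewrite -[LHS]/(chi (irr_rep l) (z ^ h)%g) chiJ.
Qed.

Lemma xi_class_sum l z g : z \in G -> g \in G ->
  \sum_(x in (z ^: G)%g) xi l (g * x)%g = #|(z ^: G)%g|%:R * omega l z * xi l g.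
Proof.
move=> Gz Gg; rewrite -mxtraceZ /xi /chi -mul_mx_scalar -class_sum_scalar //.
rewrite mulmx_sumr raddf_sum /=; apply: eq_bigr => _ /imsetP[h Gh ->].
by rewrite repr_mxM ?groupJ.
Qed.

End Multiplicities.

(** * Tensor products and the Plancherel measure *)

Section TensorProducts.

Variables (C : numClosedFieldType) (gT : finGroupType) (G : {group gT}).
Implicit Types (V W : representation C G) (g x : gT).

Local Notation Irr := (DecSocleType (regular_repr C G)).
Implicit Types l : Irr.

Lemma card_group_gt0 : 0 < #|G|%:R :> C.
Proof. by rewrite ltr0n. Qed.

Lemma parseval (a : Irr -> C) :
  \sum_(g in G) `|\sum_l a l * xi l g| ^+ 2 = #|G|%:R * \sum_l `|a l| ^+ 2.
Proof.
transitivity (\sum_(g in G) \sum_l \sum_l'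
    a l * Num.conj (a l') * (xi l g * Num.conj (xi l' g))).
  apply: eq_bigr => g _; rewrite normCK rmorph_sum mulr_suml.
  apply: eq_bigr => l _; rewrite mulr_sumr; apply: eq_bigr => l' _.
  by rewrite rmorphM mulrACA.
rewrite exchange_big /= mulr_sumr; apply: eq_bigr => l _.
rewrite exchange_big /= (bigD1 l) //= [X in _ + X]big1 => [|l' ll'].
  by rewrite -mulr_sumr xi_orthogonal eqxx normCK addr0 mulrC.
by rewrite -mulr_sumr xi_orthogonal eq_sym (negPf ll') mulr0.
Qed.

Definition plmeas (S : pred Irr) : C :=
  \sum_(l | S l) (irr_degree l)%:R ^+ 2 / #|G|%:R.

Definition plcoef (S : pred Irr) l : C := (irr_degree l)%:R *+ S l.

(** The function [f_S] of the overview. *)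
Definition plchar (S : pred Irr) g : C := \sum_l plcoef S l * xi l g.

Lemma plmeasT : plmeas predT = 1.
Proof.
have /eqP := xi_regular C (group1 G); rewrite eqxx.
rewrite /plmeas -mulr_suml => /eqP; under eq_bigr do rewrite xi1 -expr2.
by move->; rewrite divff // gt_eqF ?card_group_gt0.
Qed.

Lemma plmeas_ge0 S : 0 <= plmeas S.
Proof. by apply: sumr_ge0 => l _; rewrite divr_ge0 ?exprn_ge0 ?ler0n. Qed.

Lemma plmeas_le (S S' : pred Irr) : {subset S <= S'} -> plmeas S <= plmeas S'.
Proof.
move=> SS'; rewrite /plmeas big_mkcond [leRHS]big_mkcond ler_sum // => l _.
case: ifPn => [Sl|_]; first by rewrite ifT //; apply: SS'.
case: ifP => // _.
by rewrite divr_ge0 ?exprn_ge0 ?ler0n.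
Qed.

Lemma plmeas_le1 S : plmeas S <= 1.
Proof. by rewrite -plmeasT; apply: plmeas_le. Qed.

Lemma plchar1 S : plchar S 1%g = #|G|%:R * plmeas S.
Proof.
rewrite /plmeas mulr_sumr big_mkcond; apply: eq_bigr => l _.
rewrite xi1 /plcoef; case: (S l); last by rewrite mul0r.
by rewrite mulr1n -expr2 mulrC divfK // gt_eqF ?card_group_gt0.
Qed.

Lemma plchar_parseval S :
  \sum_(g in G) `|plchar S g| ^+ 2 = #|G|%:R ^+ 2 * plmeas S.
Proof.
rewrite parseval expr2 -mulrA; congr (_ * _).
rewrite mulr_sumr [RHS]big_mkcond; apply: eq_bigr => l _; rewrite /plcoef.
case: (S l); last by rewrite normr0 expr0n.
by rewrite mulr1n normr_nat mulrC divfK // gt_eqF ?card_group_gt0.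
Qed.

(** The left side is the contribution of a single class to Parseval's sum. *)
Lemma plchar_class S g : g \in G ->
  #|(g ^: G)%g|%:R * `|plchar S g| ^+ 2 <= #|G|%:R ^+ 2.
Proof.
move=> Gg; apply: (@le_trans _ _ (\sum_(x in G) `|plchar S x| ^+ 2)); last first.
  by rewrite plchar_parseval ler_piMr ?plmeas_le1 ?exprn_ge0 ?ler0n.
have sKG : (g ^: G)%g \subset G by rewrite class_subG.
rewrite (big_setID (g ^: G)%g) /= (finset.setIidPr sKG) mulr_natl -sumr_const.
rewrite ler_wpDr ?sumr_ge0 // => [x _|]; first by rewrite exprn_ge0.
rewrite le_eqVlt; apply/orP; left; apply/eqP; apply: eq_bigr => _ /imsetP[h Gh ->].
by congr (`|_| ^+ 2); apply: eq_bigr => l _; congr (_ * _); rewrite [RHS]chiJ.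
Qed.

Lemma triple_nonzero (S1 S2 S3 : pred Irr) (delta : C) (k : nat) l :
    0 < delta -> delta <= plmeas S1 -> delta <= plmeas S2 -> delta <= plmeas S3 ->
    4 <= k%:R * (delta ^+ 3) ^+ 2 ->
    {in G, forall g, g != 1%g -> (k <= #|(g ^: G)%g|)%N} ->
  \sum_(g in G) plchar S1 g * plchar S2 g * plchar S3 g * Num.conj (xi l g) != 0.
Proof.
move=> d0 dS1 dS2 dS3 kd kG; set n : C := #|G|%:R; have n0 : 0 < n := card_group_gt0.
set d : C := (irr_degree l)%:R; have dl0 : 0 < d by rewrite ltr0n irr_degree_gt0.
pose F g := plchar S1 g * plchar S2 g * plchar S3 g * Num.conj (xi l g).
rewrite (bigD1 1%g) //= -/(F 1%g); set A := F _.
pose B := \sum_(g in G | g != 1%g) F g; rewrite -/B.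
have leA : n ^+ 3 * delta ^+ 3 * d <= `|A|.
  rewrite /A /F !plchar1 xi1 !normrM norm_conjC !normr_nat -/n -/d.
  rewrite !(ger0_norm (plmeas_ge0 _)) ler_wpM2r ?(ltW dl0) //.
  have le_nM S : delta <= plmeas S -> n * delta <= n * plmeas S.
    by move=> dS; rewrite ler_wpM2l ?(ltW n0).
  have p0 : 0 <= n * delta by rewrite mulr_ge0 ?ltW.
  have -> : n ^+ 3 * delta ^+ 3 = n * delta * (n * delta) * (n * delta) by ring.
  apply: ler_pM => //; [exact: mulr_ge0 | | exact: le_nM].
  by apply: ler_pM => //; apply: le_nM.
suff ltB : `|B| < n ^+ 3 * delta ^+ 3 * d.
  apply: contraTneq (lt_le_trans ltB leA) => /eqP.
  by rewrite addr_eq0 => /eqP ->; rewrite normrN ltxx.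
(* With this [e] the hypothesis on [k] reads [1 <= k * e ^+ 2], so [plchar_class] bounds the third
   factor by [e * n] off the identity. *)
pose e := delta ^+ 3 / 2.
have e0 : 0 < e by rewrite divr_gt0 ?exprn_gt0 ?ltr0n.
have small g : g \in G -> g != 1%g -> `|plchar S3 g| <= e * n.
  move=> Gg ntg; have en0 : 0 <= e * n by exact: mulr_ge0 (ltW e0) (ltW n0).
  rewrite -(@ler_pXn2r _ 2) ?nnegrE //.
  have k0 : 0 < k%:R :> C.
    rewrite ltr0n lt0n; apply: contraTneq kd => ->.
    by rewrite mul0r lt_geF // ltr0n.
  have := plchar_class S3 Gg; rewrite -/n => le1.
  rewrite -(ler_pM2l k0); apply: (@le_trans _ _ (n ^+ 2)).
    by apply: le_trans le1; rewrite ler_wpM2r ?exprn_ge0 // ler_nat kG.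
  rewrite exprMn mulrA ler_peMl ?exprn_ge0 ?(ltW n0) //.
  by rewrite expr_div_n mulrA ler_pdivlMr ?exprn_gt0 ?ltr0n // mul1r -natrX.
have end0 : 0 < e * n * d by exact: mulr_gt0 (mulr_gt0 e0 n0) dl0.
(* The product of the first two factors is at most the mean of their squares. Adding the nonnegative
   term at the identity lets Parseval apply on all of [G]; the total is at most half of the main
   term. *)
apply: (@le_lt_trans _ _ (\sum_(g in G) (e * n * d) *
    ((`|plchar S1 g| ^+ 2 + `|plchar S2 g| ^+ 2) / 2))).
  rewrite /B; apply: le_trans (ler_norm_sum _ _ _) _.
  rewrite [leRHS](bigD1 1%g) //= ler_wpDl //.
    by rewrite mulr_ge0 ?(ltW end0) // divr_ge0 ?addr_ge0 ?exprn_ge0.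
  apply: ler_sum => g /andP[Gg ntg]; rewrite /F !normrM norm_conjC.
  rewrite -[X in X <= _]mulrA mulrC ler_pM ?mulr_ge0 //.
    by rewrite ler_pM ?small ?xi_norm.
  rewrite ler_pdivlMr ?ltr0n // mulr_natr -subr_ge0.
  have -> : `|plchar S1 g| ^+ 2 + `|plchar S2 g| ^+ 2 -
      `|plchar S1 g| * `|plchar S2 g| *+ 2 = (`|plchar S1 g| - `|plchar S2 g|) ^+ 2.
    by rewrite sqrrB addrAC.
  by rewrite real_exprn_even_ge0 // rpredB ?normr_real.
rewrite -mulr_sumr -mulr_suml big_split /= !plchar_parseval -/n -mulrDr.
apply: (@le_lt_trans _ _ (e * n * d * n ^+ 2)).
  rewrite ler_wpM2l ?(ltW end0) // ler_pdivrMr ?ltr0n //.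
  by rewrite ler_wpM2l ?exprn_ge0 ?(ltW n0) // -[2]/(1 + 1) lerD ?plmeas_le1.
have -> : e * n * d * n ^+ 2 = n ^+ 3 * delta ^+ 3 * d / 2.
  by rewrite /e !exprS expr0; ring.
by rewrite ltr_pdivrMr ?ltr0n // ltr_pMr ?ltr1n // !mulr_gt0 ?exprn_gt0.
Qed.

Lemma expand3 (u v w : Irr -> C) l :
  \sum_(g in G) (\sum_a u a * xi a g) * (\sum_b v b * xi b g) *
    (\sum_c w c * xi c g) * Num.conj (xi l g) =
  \sum_a \sum_b \sum_c u a * v b * w c *
    \sum_(g in G) xi a g * xi b g * xi c g * Num.conj (xi l g).
Proof.
transitivity (\sum_(g in G) \sum_a \sum_b \sum_c u a * v b * w c *
    (xi a g * xi b g * xi c g * Num.conj (xi l g))).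
  apply: eq_bigr => g _; rewrite !mulr_suml; apply: eq_bigr => a _.
  rewrite [X in X * _ * _]mulr_sumr !mulr_suml; apply: eq_bigr => b _.
  by rewrite mulr_sumr mulr_suml; apply: eq_bigr => c _; ring.
rewrite exchange_big /=; apply: eq_bigr => a _.
rewrite exchange_big /=; apply: eq_bigr => b _.
rewrite exchange_big /=; apply: eq_bigr => c _.
by rewrite mulr_sumr.
Qed.

(** Both sides expand over the same [X a b c], which are multiplicities up to the factor [#|G|] and
    hence nonnegative. If the expansion with multiplicities vanishes, so does every [X a b c] with
    [a], [b], [c] contained, and then the expansion with degrees. *)
Lemma mult_tensor3 V1 V2 V3 l :
  let T := Representation (prod_repr (Representation (prod_repr V1 V2)) V3) in
  let S (V : representation C G) : pred Irr := fun l => (0 < mult V l)%N in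
  \sum_(g in G) plchar (S V1) g * plchar (S V2) g * plchar (S V3) g
     * Num.conj (xi l g) != 0 -> (0 < mult T l)%N.
Proof.
move=> T S; apply: contraNT; rewrite -eqn0Ngt => /eqP T0.
pose X (a b c : Irr) := \sum_(g in G) xi a g * xi b g * xi c g * Num.conj (xi l g).
have X_ge0 a b c : 0 <= X a b c.
  rewrite /X (_ : \sum_(g in G) _ = (mult (Representation (prod_repr
    (Representation (prod_repr (irr_rep a) (irr_rep b))) (irr_rep c))) l)%:R * #|G|%:R).
    by rewrite mulr_ge0 ?ler0n.
  by rewrite -mult_dot; apply: eq_bigr => g _; rewrite !chi_prod.
have : \sum_a \sum_b \sum_c
    (mult V1 a)%:R * (mult V2 b)%:R * (mult V3 c)%:R * X a b c = 0.
  rewrite -expand3 -[RHS](mul0r #|G|%:R) -[X in X * _]/(0%:R) -[in RHS]T0 -mult_dot.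
  by apply: eq_bigr => g Gg; rewrite !chi_prod !(chi_mult _ Gg).
have nonneg a b c : 0 <= (mult V1 a)%:R * (mult V2 b)%:R * (mult V3 c)%:R * X a b c.
  by rewrite !mulr_ge0 ?ler0n.
move/eqP; rewrite psumr_eq0 => [/allP sum0|a _]; last first.
  by do 2!apply: sumr_ge0 => ? _; apply: nonneg.
rewrite expand3 big1 // => a _; rewrite big1 // => b _; rewrite big1 // => c _.
have := sum0 a (mem_index_enum _).
rewrite psumr_eq0 => [/allP/(_ b (mem_index_enum _))|? _]; last first.
  by apply: sumr_ge0 => ? _; apply: nonneg.
rewrite psumr_eq0 => [/allP/(_ c (mem_index_enum _))|? _]; last exact: nonneg.
rewrite -/(X a b c) !mulf_eq0 !pnatr_eq0 /plcoef /S !lt0n.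
by case: eqP => /= _; [rewrite !mul0r | case: eqP => /= _; [rewrite mulr0 !mul0r |
  case: eqP => /= _; [rewrite mulr0 mul0r | move/eqP->; rewrite mulr0]]].
Qed.

(** By the same positivity, a zero multiplicity forces every [Y b] to vanish. Weighting by degrees
    then pairs [V] and [l] with the regular character, where only the nonzero term at the identity
    survives. *)
Lemma mult_prod_full V X l : (0 < rdegree V)%N ->
    (forall b, 0 < mult X b)%N ->
  (0 < mult (Representation (prod_repr V X)) l)%N.
Proof.
move=> V0 X0; apply/negPn/negP; rewrite -eqn0Ngt => /eqP T0.
pose Y (b : Irr) := \sum_(g in G) chi V g * xi b g * Num.conj (xi l g).
have Y_ge0 b : 0 <= Y b.
  rewrite /Y (_ : \sum_(g in G) _ =
     (mult (Representation (prod_repr V (irr_rep b))) l)%:R * #|G|%:R).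
    by rewrite mulr_ge0 ?ler0n.
  by rewrite -mult_dot; apply: eq_bigr => g _; rewrite !chi_prod.
have expandY (w : Irr -> C) : \sum_b w b * Y b =
    \sum_(g in G) chi V g * (\sum_b w b * xi b g) * Num.conj (xi l g).
  under [RHS]eq_bigr => g _ do rewrite mulr_sumr mulr_suml.
  rewrite exchange_big /=; apply: eq_bigr => b _.
  by rewrite mulr_sumr; apply: eq_bigr => g _; ring.
have : \sum_b (mult X b)%:R * Y b = 0.
  rewrite expandY -[RHS](mul0r #|G|%:R) -[X in X * _]/(0%:R) -[in RHS]T0 -mult_dot.
  by apply: eq_bigr => g Gg; rewrite !chi_prod !(chi_mult X Gg).
move/eqP; rewrite psumr_eq0 => [/allP sum0|b _]; last by rewrite mulr_ge0 ?ler0n.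
have Yb0 b : Y b = 0.
  have := sum0 b (mem_index_enum _).
  by rewrite mulf_eq0 pnatr_eq0 (gtn_eqF (X0 b)) => /eqP.
have := expandY (fun b => (irr_degree b)%:R).
rewrite big1 => [/esym/eqP|b _]; last by rewrite Yb0 mulr0.
rewrite (bigD1 1%g) //= [X in _ + X]big1 => [|g /andP[Gg /negPf ntg]]; last first.
  by rewrite xi_regular // ntg mulr0 mul0r.
rewrite addr0 xi_regular // eqxx chi1 xi1 conjC_nat !mulf_eq0 !pnatr_eq0.
by rewrite (gtn_eqF V0) (gtn_eqF (irr_degree_gt0 l)) orbF gtn_eqF.
Qed.

End TensorProducts.

(** * Representations almost trivial on a small class *)

Section SpectralDensity.

Variables (C : numClosedFieldType) (gT : finGroupType) (G : {group gT}).
Implicit Types (g x z : gT).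

Local Notation Irr := (DecSocleType (regular_repr C G)).
Implicit Types l : Irr.

Lemma normC_add1 (w : C) : `|1 + w| ^+ 2 = 1 + `|w| ^+ 2 + 2 * 'Re w.
Proof.
rewrite !normCK rmorphD rmorph1 ReE mulrCA divff ?pnatr_eq0 // mulr1.
by ring.
Qed.

Lemma Re_le_norm (w : C) : 'Re w <= `|w|.
Proof. by rewrite leif_Re_Creal. Qed.

(** The eigenvalue on [l] of a walk step that stays put with probability 1/2. *)
Definition lazy_eig z l : C := (1 + omega l z) / 2.

(** Laziness makes eigenvalues with [omega] near -1 small, so a large modulus forces [omega] to be
    near 1. *)
Lemma lazy_eig_norm z l : z \in G -> `|lazy_eig z l| ^+ 2 <= (1 + 'Re (omega l z)) / 2.
Proof.
move=> Gz; rewrite normf_div expr_div_n normr_nat normC_add1.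
have w1 : `|omega l z| ^+ 2 <= 1 by rewrite exprn_ile1 ?omega_norm.
rewrite ler_pdivrMr ?exprn_gt0 ?ltr0n //.
have -> : (1 + 'Re (omega l z)) / 2 * 2 ^+ 2 = 1 + 1 + 2 * 'Re (omega l z) by field.
by rewrite lerD2r lerD2l.
Qed.

(* Up to the factor [#|G|], the probability that the lazy random walk on [G] with
   steps uniform in the class of [z] is at [g^-1] at time [t], in Fourier form. *)
Definition walk z t g : C :=
  \sum_l (irr_degree l)%:R * lazy_eig z l ^+ t * xi l g.

Lemma walk0 z g : g \in G -> walk z 0 g = #|G|%:R *+ (g == 1%g).
Proof.
by move=> Gg; rewrite -xi_regular //; apply: eq_bigr => l _; rewrite expr0 mulr1.
Qed.

Lemma walkS z t g : z \in G -> g \in G ->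
  walk z t.+1 g =
  (walk z t g + #|(z ^: G)%g|%:R^-1 * \sum_(x in (z ^: G)%g) walk z t (g * x)%g) / 2.
Proof.
move=> Gz Gg; have K0 : #|(z ^: G)%g|%:R != 0 :> C.
  by rewrite pnatr_eq0 -lt0n; apply/card_gt0P; exists z; apply: class_refl.
rewrite /walk exchange_big /= mulr_sumr -big_split /= mulr_suml.
apply: eq_bigr => l _; rewrite -mulr_sumr xi_class_sum // exprS /lazy_eig.
by field.
Qed.

Lemma walk_sum z t : z \in G -> \sum_(g in G) walk z t g = #|G|%:R.
Proof.
move=> Gz; elim: t => [|t IHt].
  under eq_bigr => g Gg do rewrite walk0 //.
  rewrite (bigD1 1%g) //= eqxx big1 ?addr0 // => g /andP[_ /negPf->].
  by rewrite mulr0n.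
have shift x : x \in (z ^: G)%g -> \sum_(g in G) walk z t (g * x)%g = #|G|%:R.
  case/imsetP=> h Gh ->; rewrite -IHt [RHS](reindex_inj (mulIg (z ^ h)%g)) /=.
  by apply: eq_bigl => g; rewrite groupMr ?groupJ.
under eq_bigr => g Gg do rewrite walkS //.
rewrite -mulr_suml big_split /= IHt -mulr_sumr exchange_big /=.
under eq_bigr => x Kx do rewrite shift //.
rewrite sumr_const -[#|G|%:R *+ _]mulr_natl mulKf.
  by rewrite -mulr2n -[_ *+ 2]mulr_natr mulfK ?pnatr_eq0.
by rewrite pnatr_eq0 -lt0n; apply/card_gt0P; exists z; apply: class_refl.
Qed.

Lemma walk_supp z (D : nat -> {set gT}) t g :
    z \in G -> 1%g \in D 0%N ->
    (forall t, D t \subset D t.+1) ->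
    (forall t x h, x \in (z ^: G)%g -> h \in D t -> (h * x^-1)%g \in D t.+1) ->
  g \in G -> walk z t g != 0 -> g \in D t.
Proof.
move=> Gz D0 DS Dx; elim: t g => [|t IHt] g Gg.
  by rewrite walk0 //; have [->|] := eqVneq g 1%g; rewrite ?mulr0n ?eqxx.
rewrite walkS //; apply: contraR => gD.
have walk_out h : h \in G -> h \notin D t -> walk z t h = 0.
  by move=> Gh; apply: contraNeq; apply: IHt.
rewrite walk_out // ?(contra (fintype.subsetP (DS t) g)) // add0r.
rewrite big1 ?mulr0 ?mul0r // => x Kx.
have Gx : x \in G by case/imsetP: Kx => h Gh ->; rewrite groupJ.
by rewrite walk_out ?groupM //; apply: contra gD => /(Dx _ _ _ Kx); rewrite mulgK.
Qed.

Lemma walk_norm z t :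
  \sum_(g in G) `|walk z t g| ^+ 2 =
  #|G|%:R * \sum_l (irr_degree l)%:R ^+ 2 * `|lazy_eig z l| ^+ (2 * t).
Proof.
rewrite parseval; congr (_ * _); apply: eq_bigr => l _.
by rewrite normrM normrX exprMn normr_nat -exprM mulnC.
Qed.

(** Cauchy-Schwarz on the support: the total mass [n] lives on [D], and [walk_norm] puts the sum of
    squares in spectral form. *)
Lemma return_probability z (D : {set gT}) t : z \in G ->
    {in G, forall g, walk z t g != 0 -> g \in D} ->
  1 <= #|D|%:R * \sum_l (irr_degree l)%:R ^+ 2 / #|G|%:R * `|lazy_eig z l| ^+ (2 * t).
Proof.
move=> Gz suppD; set n : C := #|G|%:R; set B : C := #|D|%:R.
have n0 : 0 < n := card_group_gt0 C G.
have sum_supp (F : C -> C) : F 0 = 0 ->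
    \sum_(g in G) F (walk z t g) = \sum_(g in G | g \in D) F (walk z t g).
  move=> F0; rewrite [RHS]big_mkcondr /=; apply: eq_bigr => g Gg; case: ifPn => // gD.
  have [->//|nz] := eqVneq (walk z t g) 0.
  by rewrite (suppD g Gg nz) in gD.
have D_le : \sum_(g in G | g \in D) n ^+ 2 <= B * n ^+ 2.
  rewrite sumr_const -mulr_natl ler_wpM2r ?exprn_ge0 ?(ltW n0) // ler_nat.
  by apply: subset_leq_card; apply/fintype.subsetP => g /andP[].
have n_le : n <= \sum_(g in G | g \in D) `|walk z t g|.
  rewrite -(sum_supp (fun w => `|w|)) ?normr0 //.
  by rewrite -[leLHS](ger0_norm (ltW n0)) /n -(walk_sum t Gz) ler_norm_sum.
have B0 : 0 < B.
  rewrite ltr0n lt0n cards_eq0; apply: contraTneq n_le => ->.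
  by rewrite big_pred0 ?lt_geF // => g; rewrite inE andbF.
have: n ^+ 2 <= B * \sum_(g in G) `|walk z t g| ^+ 2.
  (* Cauchy-Schwarz is obtained by summing [(B * |w| - n) ^+ 2 >= 0] over [D]. *)
  rewrite -(ler_pM2l B0) -(lerD2r (B * n ^+ 2)).
  apply: (@le_trans _ _ (\sum_(g in G | g \in D) (2 * n * B * `|walk z t g|))).
    have -> : B * n ^+ 2 + B * n ^+ 2 = 2 * n * B * n by ring.
    rewrite -mulr_sumr.
    by rewrite ler_wpM2l // !mulr_ge0 ?ler0n.
  apply: le_trans (lerD (lexx _) D_le).
  rewrite (sum_supp (fun w => `|w| ^+ 2)) ?normr0 ?expr0n //.
  rewrite mulrA mulr_sumr -big_split /= ler_sum // => g _.
  rewrite -subr_ge0 (_ : _ - _ = (B * `|walk z t g| - n) ^+ 2); last by ring.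
  by rewrite real_exprn_even_ge0 // rpredB ?realM ?normr_real ?ger0_real ?ler0n.
rewrite walk_norm -/n; under [in X in _ -> X]eq_bigr do rewrite mulrAC.
rewrite -mulr_suml mulrA ler_pdivlMr // mul1r.
by rewrite mulrCA expr2 ler_pM2l.
Qed.

Definition near_trivial z (eps : C) : pred Irr := fun l => 1 - eps <= 'Re (omega l z).

(** In the spectral sum, the near-trivial [l] have factor at most 1, and all others at most
    [(1 - eps / 2) ^+ t]. *)
Lemma near_trivial_density z (D : {set gT}) t (eps : C) : z \in G ->
    0 <= eps <= 1 -> {in G, forall g, walk z t g != 0 -> g \in D} ->
  1 <= #|D|%:R * (plmeas (near_trivial z eps) + (1 - eps / 2) ^+ t).
Proof.
move=> Gz /andP[eps0 eps1] suppD; apply: le_trans (return_probability Gz suppD) _.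
rewrite ler_wpM2l ?ler0n //.
have r0 : 0 <= 1 - eps / 2.
  by rewrite subr_ge0 ler_pdivrMr ?ltr0n // mul1r (le_trans eps1) // ler1n.
have eR : eps \is Num.real by rewrite ger0_real.
have -> : (1 - eps / 2) ^+ t =
    \sum_(l : Irr) (irr_degree l)%:R ^+ 2 / #|G|%:R * (1 - eps / 2) ^+ t :> C.
  by rewrite -mulr_suml -/(plmeas predT) plmeasT mul1r.
rewrite /plmeas [X in _ <= X + _]big_mkcond -big_split /= ler_sum // => l _.
have M0 : 0 <= (irr_degree l)%:R ^+ 2 / #|G|%:R :> C.
  by rewrite divr_ge0 ?exprn_ge0 ?ler0n.
rewrite exprM; case: ifPn => Sl.
  apply: ler_wpDr; first exact: mulr_ge0 M0 (exprn_ge0 _ r0).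
  rewrite ler_piMr // exprn_ile1 //.
    by rewrite exprn_ge0.
  apply: le_trans (lazy_eig_norm l Gz) _; rewrite ler_pdivrMr ?ltr0n // mul1r.
  rewrite -[2]/(1 + 1) lerD2l.
  exact: le_trans (Re_le_norm _) (omega_norm l Gz).
rewrite add0r ler_wpM2l //; apply: lerXn2r; rewrite ?nnegrE ?exprn_ge0 //.
apply: le_trans (lazy_eig_norm l Gz) _.
rewrite ler_pdivrMr ?ltr0n // mulrBl divfK ?pnatr_eq0 // mul1r.
rewrite -[2]/(1 + 1) -addrA lerD2l ltW // real_ltNge ?Creal_Re //.
by rewrite rpredB ?real1.
Qed.

End SpectralDensity.

(** * Near-trivial representations have measure at most one half *)

Section HalfMeasure.

Variables (C : numClosedFieldType) (gT : finGroupType) (G : {group gT}).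

Local Notation Irr := (DecSocleType (regular_repr C G)).
Implicit Types l : Irr.

Definition plmean (f : Irr -> C) : C :=
  \sum_l (irr_degree l)%:R ^+ 2 / #|G|%:R * f l.

Lemma plweight_ge0 l : 0 <= (irr_degree l)%:R ^+ 2 / #|G|%:R :> C.
Proof. by rewrite divr_ge0 ?exprn_ge0 ?ler0n. Qed.

Lemma plmean_le f h : (forall l, f l <= h l) -> plmean f <= plmean h.
Proof. by move=> fh; apply: ler_sum => l _; rewrite ler_wpM2l ?plweight_ge0. Qed.

Lemma plmeanD f h : plmean (fun l => f l + h l) = plmean f + plmean h.
Proof. by rewrite -big_split; apply: eq_bigr => l _; rewrite mulrDr. Qed.

Lemma plmeanZ a f : plmean (fun l => a * f l) = a * plmean f.
Proof. by rewrite mulr_sumr; apply: eq_bigr => l _; rewrite mulrCA. Qed.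

Lemma plmean_cst a : plmean (fun=> a) = a.
Proof. by rewrite /plmean -mulr_suml -/(plmeas predT) plmeasT mul1r. Qed.

Lemma plmean_Re f : plmean (fun l => 'Re (f l)) = 'Re (plmean f).
Proof.
rewrite [in RHS]/plmean raddf_sum; apply: eq_bigr => l _.
by rewrite /= ReMl // ger0_real ?plweight_ge0.
Qed.

Lemma plmeas_plmean (S : pred Irr) : plmeas S = plmean (fun l => (S l)%:R).
Proof.
rewrite /plmeas big_mkcond; apply: eq_bigr => l _.
by case: (S l); rewrite ?mulr1 ?mulr0.
Qed.

Lemma plmean_omega z : z \in G -> z != 1%g -> plmean (fun l => omega l z) = 0.
Proof.
move=> Gz /negPf ntz; have := xi_regular C Gz; rewrite ntz mulr0n => E.
rewrite -[RHS](mul0r #|G|%:R^-1) -E mulr_suml; apply: eq_bigr => l _.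
by rewrite -omegaK; ring.
Qed.

(** By [xi_class_sum] the mean is a sum of regular character values at [z * x] for [x] in the class,
    and only [x = z^-1] contributes. *)
Lemma plmean_omega2 z : z \in G ->
  plmean (fun l => omega l z ^+ 2) =
  #|(z ^: G)%g|%:R^-1 *+ (z^-1 \in z ^: G)%g.
Proof.
move=> Gz; set k : C := #|(z ^: G)%g|%:R.
have k0 : k != 0 by rewrite pnatr_eq0 -lt0n; apply/card_gt0P; exists z; apply: class_refl.
have n0 : #|G|%:R != 0 :> C by rewrite pnatr_eq0 -lt0n.
have: \sum_(x in (z ^: G)%g) \sum_(l : Irr) (irr_degree l)%:R * xi l (z * x)%g =
    #|G|%:R *+ (z^-1 \in z ^: G)%g.
  have regE x : x \in (z ^: G)%g ->
      \sum_(l : Irr) (irr_degree l)%:R * xi l (z * x)%g = #|G|%:R *+ (x == z^-1)%g.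
    case/imsetP=> h Gh ->; rewrite xi_regular ?(groupM Gz) ?groupJ //.
    by rewrite -eq_invg_mul eq_sym.
  rewrite (eq_bigr _ regE).
  have [Kz|Kz] := boolP (_ \in _).
    rewrite (bigD1 _ Kz) /= eqxx big1 ?addr0 // => x /andP[_ /negPf->].
    by rewrite mulr0n.
  rewrite big1 // => x Kx; case: eqP => // xz.
  by rewrite -xz Kx in Kz.
rewrite exchange_big /= => E.
have -> : k^-1 *+ (z^-1 \in z ^: G)%g = (k * #|G|%:R)^-1 * (#|G|%:R *+ (z^-1 \in z ^: G)%g).
  by rewrite mulrnAr invfM divfK.
rewrite -E mulr_sumr; apply: eq_bigr => l _.
rewrite -mulr_sumr xi_class_sum // -[xi l z]omegaK -/k.
by field; rewrite n0 k0.
Qed.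

(* The indicator of [u >= 19/20] is bounded by a quadratic polynomial in
   [u = 'Re (omega l z)] whose mean is at most 1/2. When [z] is a central
   involution ([rho = 1]), 1/2 is attained and another polynomial is needed. *)
Lemma near_trivial_half z : z \in G -> z != 1%g ->
  plmeas (near_trivial z 20^-1 : pred Irr) <= 2^-1.
Proof.
move=> Gz ntz; pose u l := 'Re (omega l z).
have uR l : u l \is Num.real by apply: Creal_Re.
have u1 l : u l <= 1 by exact: le_trans (Re_le_norm _) (omega_norm l Gz).
have uN1 l : - 1 <= u l.
  rewrite lerNl -raddfN /=; apply: le_trans (Re_le_norm _) _.
  by rewrite normrN omega_norm.
have c0 : 0 <= 1 - 20^-1 :> C by rewrite subr_ge0 invf_le1 ?ltr0n ?ler1n.
have Eu : plmean u = 0 by rewrite plmean_Re plmean_omega // raddf0.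
pose rho : C := #|(z ^: G)%g|%:R^-1 *+ (z^-1 \in z ^: G)%g.
(* The averaged expression is the real part of [omega ^+ 2]. *)
have Eu2 : plmean (fun l => 2 * u l ^+ 2 - `|omega l z| ^+ 2) = rho.
  have rhoR : rho \is Num.real by rewrite /rho rpredMn // rpredV realn.
  rewrite -(Creal_ReP _ rhoR) /rho -plmean_omega2 // -plmean_Re.
  apply: eq_bigr => l _; congr (_ * _).
  by rewrite [in RHS]expr2 ReM normC2_Re_Im -/(u l); ring.
have mean_le a b c : (forall l, (near_trivial z 20^-1 l)%:R <=
    a + b * u l + c * (2 * u l ^+ 2 - `|omega l z| ^+ 2)) ->
  plmeas (near_trivial z 20^-1 : pred Irr) <= a + c * rho.
  move=> le_l; rewrite plmeas_plmean; apply: le_trans (plmean_le le_l) _.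
  by rewrite !plmeanD !plmeanZ plmean_cst Eu Eu2 mulr0 addr0.
have u_le_norm l : u l ^+ 2 <= `|omega l z| ^+ 2.
  by rewrite normC2_Re_Im lerDl -real_normK ?exprn_ge0 ?Creal_Im.
have omega1 l : `|omega l z| ^+ 2 <= 1 by rewrite exprn_ile1 ?omega_norm.
(* For [rho = 1] the polynomial is [3/2 + u/2 - u^2], and [u^2 <= |omega|^2] passes from [- u^2] to
   the real part of [- omega^2]. *)
have [rho1|rho1] := eqVneq rho 1.
  suff : plmeas (near_trivial z 20^-1 : pred Irr) <= 3 / 2 + (-1) * rho.
    by rewrite rho1; congr (_ <= _); field.
  apply: (mean_le _ (2^-1)) => l.
  apply: (@le_trans _ _ (3 / 2 + 2^-1 * u l - u l ^+ 2)); last first.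
    rewrite -subr_ge0.
    rewrite [X in 0 <= X](_ : _ = `|omega l z| ^+ 2 - u l ^+ 2); last by ring.
    by rewrite subr_ge0.
  have mu0 : 0 <= 1 - u l by rewrite subr_ge0.
  have pu0 : 0 <= 1 + u l by rewrite addrC -lerBlDr sub0r.
  have [u_big | _] /= := boolP (near_trivial z 20^-1 l).
    rewrite -subr_ge0 [X in 0 <= X](_ : _ = (1 - u l) * (2^-1 + u l)); last by field.
    by rewrite mulr_ge0 // addr_ge0 ?invr_ge0 ?ler0n // (le_trans c0 u_big).
  rewrite [X in 0 <= X](_ : _ = (1 + u l) / 2 + (1 - u l) * (1 + u l)); last by field.
  by rewrite addr_ge0 ?divr_ge0 ?mulr_ge0 ?ler0n.
have rho2 : rho <= 2^-1.
  have K0 : (0 < #|(z ^: G)%g|)%N by apply/card_gt0P; exists z; apply: class_refl.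
  move: rho1; rewrite /rho; case: (_ \in _); last by rewrite mulr0n invr_ge0 ler0n.
  rewrite mulr1n => k1; rewrite lef_pV2 ?posrE ?ltr0n ?ler_nat //.
  by rewrite ltn_neqAle K0 andbT eq_sym; apply: contraNneq k1 => ->; rewrite invr1.
(* Otherwise the polynomial is [1/4 + u/2 + u^2/3]; here [|omega| <= 1] is what brings in the real
   part of [omega^2]. *)
apply: (@le_trans _ _ (5 / 12 + 6^-1 * rho)); last first.
  rewrite -subr_ge0 [X in 0 <= X](_ : _ = (2^-1 - rho) / 6); last by field.
  by rewrite divr_ge0 ?ler0n // subr_ge0.
apply: (mean_le _ (2^-1)) => l.
apply: (@le_trans _ _ (4^-1 + u l / 2 + u l ^+ 2 / 3)); last first.
  rewrite -subr_ge0 [X in 0 <= X](_ : _ = (1 - `|omega l z| ^+ 2) / 6); last by field.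
  by rewrite divr_ge0 ?ler0n // subr_ge0.
have [u_big | _] /= := boolP (near_trivial z 20^-1 l).
  rewrite -subr_ge0 [X in 0 <= X](_ : _ = (u l - (1 - 20^-1)) * (7 / 6)
    + (1 - u l) * (1 - u l) / 3 + 40^-1); last by field.
  have du0 : 0 <= u l - (1 - 20^-1) by rewrite subr_ge0.
  have mu0 : 0 <= 1 - u l by rewrite subr_ge0.
  apply: addr_ge0; last by rewrite invr_ge0 ler0n.
  apply: addr_ge0; first by rewrite (mulr_ge0 du0) // divr_ge0 ?ler0n.
  by rewrite divr_ge0 ?ler0n // (mulr_ge0 mu0 mu0).
rewrite [X in 0 <= X](_ : _ = (u l + 3 / 4) ^+ 2 / 3 + 16^-1); last by field.
rewrite addr_ge0 ?invr_ge0 ?ler0n // divr_ge0 ?ler0n // real_exprn_even_ge0 //.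
by rewrite rpredD // rpred_div ?realn.
Qed.

End HalfMeasure.

(** * Eigenvalues near 1 in products, sums and constituents *)

Section Eigenvalues.

Variables (C : numClosedFieldType) (gT : finGroupType) (G : {group gT}).
Implicit Types (V W : representation C G) (z : gT).

Local Notation Irr := (DecSocleType (regular_repr C G)).
Implicit Types l : Irr.

(** The spectrum enters only through characters of powers of [z], so tensor products and direct sums
    become operations on lists. *)
Definition eigs_near V z (eps : C) : Prop := exists s : seq C,
  [/\ {in s, forall a, a ^+ #[z]%g = 1}, {in s, forall a, `|1 - a| <= eps}
    & forall j, chi V (z ^+ j)%g = \sum_(a <- s) a ^+ j].

(** Distances to 1 add, since [1 - a * b = (1 - a) + a * (1 - b)] and [|a| = 1]. *)
Lemma eigs_near_prod V W z e f : eigs_near V z e -> eigs_near W z f ->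
  eigs_near (Representation (prod_repr V W)) z (e + f).
Proof.
move=> [s [s1 se sE]] [t [t1 tf tE]]; exists [seq a * b | a <- s, b <- t]; split.
- by move=> _ /allpairsP[[a b] /= [sa tb ->]]; rewrite exprMn s1 ?t1 ?mulr1.
- move=> _ /allpairsP[[a b] /= [sa tb ->]].
  have a1 := unity_norm (order_gt0 z) (s1 a sa).
  rewrite (_ : 1 - a * b = (1 - a) + a * (1 - b)); last by ring.
  apply: le_trans (ler_normD _ _) _; rewrite normrM a1 mul1r.
  by apply: lerD; [exact: se | exact: tf].
- move=> j; rewrite chi_prod sE tE big_allpairs_dep /= mulr_suml.
  apply: eq_bigr => a _; rewrite mulr_sumr; apply: eq_bigr => b _.
  by rewrite exprMn.
Qed.

Lemma eigs_near_dadd V W z e : eigs_near V z e -> eigs_near W z e ->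
  eigs_near (dadd_grepr V W) z e.
Proof.
move=> [s [s1 se sE]] [t [t1 te tE]]; exists (s ++ t); split=> [a|a|j].
- by rewrite mem_cat => /orP[/s1|/t1].
- by rewrite mem_cat => /orP[/se|/te].
- by rewrite chi_dadd sE tE big_cat.
Qed.

Lemma eigs_near_repr0 z e : eigs_near grepr0 z e.
Proof.
by exists [::]; split=> // j; rewrite big_nil /chi /mxtrace big_ord0.
Qed.

(** On these roots of unity conjugation is the power [#[z].-1], so [|p a|^2] is a polynomial in
    [a]. *)
Lemma sum_norm_horner V z s (p : {poly C}) :
    {in s, forall a, a ^+ #[z]%g = 1} ->
    (forall j, chi V (z ^+ j)%g = \sum_(a <- s) a ^+ j) ->
  \sum_(a <- s) `|p.[a]| ^+ 2 =
  \sum_(i < size p) \sum_(j < size p)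
     p`_i * Num.conj p`_j * chi V (z ^+ (i + #[z].-1 * j))%g.
Proof.
move=> s1 sE; under [RHS]eq_bigr => i _.
  under eq_bigr => j _ do rewrite sE mulr_sumr.
  rewrite exchange_big /=; over.
rewrite exchange_big /= big_seq [RHS]big_seq; apply: eq_bigr => a sa.
have a1 := unity_norm (order_gt0 z) (s1 a sa).
have a0 : a != 0 by rewrite -normr_eq0 a1 oner_eq0.
have aV : Num.conj a = a ^+ #[z]%g.-1.
  apply: (mulfI a0); rewrite -exprS prednK ?order_gt0 // s1 //.
  by rewrite -normCK a1 expr1n.
rewrite normCK horner_coef rmorph_sum mulr_suml; apply: eq_bigr => i _.
rewrite mulr_sumr; apply: eq_bigr => j _.
by rewrite rmorphM rmorphXn /= aV exprD exprM; ring.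
Qed.

(* The sum of [|p a|^2] over the eigenvalues [a] of [z] is linear in the character
   and nonnegative, so if [p] vanishes at all the eigenvalues of [z] on [V] then it
   vanishes at its eigenvalues on every constituent of [V]. *)
Lemma eigs_near_constituent V z e l : z \in G ->
  eigs_near V z e -> (0 < mult V l)%N -> 1 - e <= 'Re (omega l z).
Proof.
move=> Gz [s [s1 se sE]] Vl.
pose p := \prod_(b <- s) ('X - b%:P).
pose Phi W : C := \sum_(i < size p) \sum_(j < size p)
     p`_i * Num.conj p`_j * chi W (z ^+ (i + #[z]%g.-1 * j))%g.
have PhiV : Phi V = 0.
  rewrite /Phi -(sum_norm_horner p s1 sE) big_seq big1 // => a sa.
  have /rootP-> : root p a by rewrite root_prod_XsubC.
  by rewrite normr0 expr0n.
have Phi_ge0 W : 0 <= Phi W.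
  have [t [_ t1 _ tE]] := repr_spectrum W Gz.
  rewrite /Phi -(sum_norm_horner p t1 tE).
  by apply: sumr_ge0 => a _; rewrite exprn_ge0.
have PhiE : Phi V = \sum_l (mult V l)%:R * Phi (irr_rep l).
  rewrite /Phi; under [RHS]eq_bigr => l' _ do rewrite mulr_sumr.
  rewrite [RHS]exchange_big /=; apply: eq_bigr => i _.
  under [RHS]eq_bigr => l' _ do rewrite mulr_sumr.
  rewrite [RHS]exchange_big /=; apply: eq_bigr => j _.
  rewrite chi_mult ?groupX // mulr_sumr; apply: eq_bigr => l' _.
  by rewrite mulrCA.
have /eqP := PhiV; rewrite PhiE psumr_eq0 => [/allP/(_ l (mem_index_enum _))|l' _]; last first.
  by rewrite mulr_ge0 ?ler0n.
rewrite mulf_eq0 pnatr_eq0 (gtn_eqF Vl) /= => Phil0.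
have [t [tsize t1 _ tE]] := repr_spectrum (irr_rep l) Gz.
have t_le : {in t, forall a, 1 - e <= 'Re a}.
  move=> a ta; have sa : a \in s.
    move: Phil0; rewrite /Phi -(sum_norm_horner p t1 tE).
    rewrite psumr_eq0 => [/allP/(_ a ta)|b _]; last by rewrite exprn_ge0.
    by rewrite /= sqrf_eq0 normr_eq0 -/(root p a) root_prod_XsubC.
  have := le_trans (Re_le_norm _) (se a sa).
  rewrite raddfB /= (Creal_ReP _ (real1 _)) => le1.
  by rewrite lerBlDr addrC -lerBlDr.
have := tE 1%N; rewrite expg1 -/(xi l z) => xiE.
have d0 : 0 < (irr_degree l)%:R :> C by rewrite ltr0n irr_degree_gt0.
(* [omega] is the average of the eigenvalues, so a lower bound on their real parts passes to it. *)
have Re_omega : 'Re (omega l z) = (irr_degree l)%:R^-1 * \sum_(a <- t) 'Re a.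
  rewrite /omega mulrC ReMl ?rpredV ?realn // xiE raddf_sum /=.
  by congr (_ * _); apply: eq_bigr => a _; rewrite expr1.
rewrite Re_omega ler_pdivlMl // mulr_natl -[irr_degree l]tsize.
have -> : (1 - e) *+ size t = \sum_(a <- t) (1 - e).
  by rewrite big_const_seq count_predT iter_addr_0.
by rewrite big_seq [leRHS]big_seq; apply: ler_sum.
Qed.

(** Turns a set of irreducibles into a representation that contains each of them. *)
Definition irr_dsum (S : pred Irr) : representation C G :=
  \big[dadd_grepr/grepr0]_(l | S l) irr_rep l.

Lemma chi_irr_dsum S g : chi (irr_dsum S) g = \sum_(l | S l) xi l g.
Proof.
apply: (big_morph (fun V => chi V g) (fun V W => chi_dadd V W g)).
by rewrite /chi /mxtrace big_ord0.
Qed.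

Lemma mult_irr_dsum (S : pred Irr) l : S l -> (0 < mult (irr_dsum S) l)%N.
Proof.
move=> Sl; rewrite -(ltr0n C) -(pmulr_lgt0 _ (card_group_gt0 C G)).
rewrite -mult_dot; under eq_bigr => g Gg do rewrite chi_irr_dsum mulr_suml.
rewrite exchange_big /= (bigD1 l) //= [X in _ + X]big1 => [|l' /andP[_ /negPf ll']].
  by rewrite xi_orthogonal eqxx addr0 card_group_gt0.
by rewrite xi_orthogonal ll'.
Qed.

Lemma eigs_near_irr_dsum (S : pred Irr) z e :
    (forall l, S l -> eigs_near (irr_rep l) z e) ->
  eigs_near (irr_dsum S) z e.
Proof.
move=> Se; rewrite /irr_dsum.
by apply: (big_ind (fun V => eigs_near V z e)) => //;
  [exact: eigs_near_repr0 | move=> V W; exact: eigs_near_dadd].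
Qed.

End Eigenvalues.

(** * An invariant Hermitian form *)

Section InvariantForm.

Variables (C : numClosedFieldType) (gT : finGroupType) (G : {group gT}).
Variable V : representation C G.
Implicit Types (u w : 'rV[C]_(rdegree V)) (g x : gT).

(** Weyl's unitary trick: the standard Hermitian form summed over the translates by [G]. *)
Definition hform u w : C :=
  \sum_(g in G) \sum_j (u *m V g) 0 j * Num.conj ((w *m V g) 0 j).

Lemma hformJ u w x : x \in G -> hform (u *m V x) (w *m V x) = hform u w.
Proof.
move=> Gx; rewrite /hform [RHS](reindex_inj (mulgI x)) /=.
apply: eq_big => [g|g Gg]; first by rewrite groupMl.
by apply: eq_bigr => j _; rewrite repr_mxM // !mulmxA.
Qed.

Lemma hform_suml (I : finType) (A : {pred I}) (F : I -> 'rV_(rdegree V)) w :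
  hform (\sum_(i in A) F i) w = \sum_(i in A) hform (F i) w.
Proof.
rewrite exchange_big; apply: eq_bigr => g _.
rewrite exchange_big; apply: eq_bigr => j _.
by rewrite mulmx_suml summxE mulr_suml.
Qed.

Lemma hformZl a u w : hform (a *: u) w = a * hform u w.
Proof.
rewrite mulr_sumr; apply: eq_bigr => g _; rewrite mulr_sumr; apply: eq_bigr => j _.
by rewrite -scalemxAl mxE mulrA.
Qed.

Lemma hform_ge0 u : 0 <= hform u u.
Proof. by do 2!apply: sumr_ge0 => ? _; apply: mul_conjC_ge0. Qed.

Lemma hform_gt0 u : u != 0 -> 0 < hform u u.
Proof.
move=> nzu; rewrite lt0r hform_ge0 andbT; apply: contra nzu.
rewrite psumr_eq0 => [/allP/(_ 1%g (mem_index_enum _))|g _]; last first.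
  by apply: sumr_ge0 => ? _; apply: mul_conjC_ge0.
rewrite group1 /= psumr_eq0 => [/allP u0|j _]; last exact: mul_conjC_ge0.
apply/eqP/rowP=> j; apply/eqP; have := u0 j (mem_index_enum _).
by rewrite repr_mx1 mulmx1 /= mul_conjC_eq0 mxE.
Qed.

Lemma hform_Re_le u w : 2 * 'Re (hform u w) <= hform u u + hform w w.
Proof.
rewrite raddf_sum mulr_sumr -big_split; apply: ler_sum => g _ /=.
rewrite raddf_sum mulr_sumr -big_split; apply: ler_sum => j _ /=.
set a := _ 0 j; set b := _ 0 j.
rewrite ReE mulrCA divff ?pnatr_eq0 // mulr1 rmorphM /= conjCK -subr_ge0.
rewrite [X in 0 <= X](_ : _ = (a - b) * Num.conj (a - b)); first exact: mul_conjC_ge0.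
by rewrite rmorphB /=; ring.
Qed.

End InvariantForm.

Section NearTrivial.

Variables (C : numClosedFieldType) (gT : finGroupType) (G : {group gT}).
Local Notation Irr := (DecSocleType (regular_repr C G)).

(* Summing [h (v x, v)] over the class of [z] gives [omega] times the class size,
   while every summand has real part at most [h (v, v)]; so a single eigenvalue
   of [z] cannot be far from 1 when [omega] is close to 1. *)
Lemma eigenvalue_class_average (l : Irr) z a : z \in G ->
    eigenvalue (irr_rep l z) a ->
  1 - 'Re a <= #|(z ^: G)%g|%:R * (1 - 'Re (omega l z)).
Proof.
move=> Gz /eigenvalueP[v va nzv]; set k : C := #|(z ^: G)%g|%:R.
pose V : representation C G := irr_rep l; pose q := hform v v.
have q0 : 0 < q := hform_gt0 nzv.
have zK : z \in (z ^: G)%g := class_refl G z.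
have sum_q : \sum_(x in (z ^: G)%g) 'Re (hform (v *m V x) v) = k * 'Re (omega l z) * q.
  rewrite -raddf_sum -hform_suml -mulmx_sumr.
  have /= -> := class_sum_scalar l Gz.
  rewrite mul_mx_scalar hformZl /= ReMr ?ger0_real ?hform_ge0 //.
  by rewrite ReMl // realn.
have le_q x : x \in (z ^: G)%g -> 'Re (hform (v *m V x) v) <= q.
  case/imsetP=> h Gh ->.
  have := hform_Re_le (v *m V (z ^ h)%g) v; rewrite hformJ ?groupJ // -/q.
  by rewrite -mulr2n -[q *+ 2]mulr_natl ler_pM2l ?ltr0n.
(* The summand at [z] itself equals ['Re a * q]; the other [k - 1] are at most [q]. *)
have: k * 'Re (omega l z) * q <= 'Re a * q + (k - 1) * q.
  rewrite -sum_q (bigD1 z) //= va hformZl ReMr ?ger0_real ?hform_ge0 // lerD2l.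
  have -> : (k - 1) * q = \sum_(x in (z ^: G)%g | x != z) q.
    rewrite sumr_const -mulr_natl; congr (_ * _).
    have := cardD1 z (mem (z ^: G)%g); rewrite zK add1n.
    rewrite /k => ->; rewrite -natr1 addrK; congr (_%:R).
    by apply: eq_card => x; rewrite !inE andbC.
  by apply: ler_sum => x /andP[Kx _]; apply: le_q.
rewrite -mulrDl ler_pM2r // => le1.
rewrite -subr_ge0 (_ : _ - _ = 'Re a + (k - 1) - k * 'Re (omega l z)); last by ring.
by rewrite subr_ge0.
Qed.

(** On the unit circle [|1 - a|^2 = 2 * (1 - 'Re a)], which explains the threshold once the class
    size is accounted for. *)
Lemma near_trivial_eigs (l : Irr) z (eps : C) : z \in G -> 0 <= eps ->
    near_trivial z (eps ^+ 2 / (2 * #|(z ^: G)%g|%:R)) l ->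
  eigs_near (irr_rep l) z eps.
Proof.
move=> Gz eps0; rewrite /near_trivial lerBlDr addrC -lerBlDr => le_omega.
have [s [_ s1 seig sE]] := repr_spectrum (irr_rep l) Gz.
exists s; split=> // a sa.
have a1 := unity_norm (order_gt0 z) (s1 a sa).
rewrite -(@ler_pXn2r _ 2) ?nnegrE // normC_add1 normrN a1 expr1n raddfN /=.
rewrite (_ : _ + _ = 2 * (1 - 'Re a)); last by ring.
have k0 : 0 < #|(z ^: G)%g|%:R :> C.
  by rewrite ltr0n; apply/card_gt0P; exists z; apply: class_refl.
rewrite -ler_pdivlMl ?ltr0n //.
apply: le_trans (eigenvalue_class_average Gz (seig a sa)) _.
rewrite -ler_pdivlMl //; apply: le_trans le_omega _.
by rewrite invfM mulrCA mulrA [_^-1 * _]mulrC.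
Qed.

End NearTrivial.

(** * Tensor powers *)

Section TensorPowers.

Variables (C : numClosedFieldType) (gT : finGroupType) (G : {group gT}).
Implicit Types V : representation C G.
Local Notation Irr := (DecSocleType (regular_repr C G)).

(** There are [n.+1] factors, so this matches [tensor_exp V n.+1]. *)
Definition tensor_iter V n : representation C G :=
  iter n (fun W : representation C G => Representation (prod_repr V W)) V.

Definition contained V : pred Irr := fun l => (0 < mult V l)%N.

Lemma eigs_near_iter V n z e : eigs_near V z e ->
  eigs_near (tensor_iter V n) z (n.+1%:R * e).
Proof.
move=> Ve; elim: n => [|n IHn]; first by rewrite mul1r.
have -> : n.+2%:R * e = e + n.+1%:R * e by rewrite -[n.+2]add1n natrD mulrDl mul1r.
exact: eigs_near_prod.
Qed.

Lemma contained_iter_full V n : (0 < rdegree V)%N ->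
  (forall l, contained (tensor_iter V 2) l) ->
  forall l, contained (tensor_iter V n.+2) l.
Proof.
move=> V0 full2; elim: n => [//|n IHn] l.
exact: mult_prod_full.
Qed.

Lemma near_trivial_sub z e f (l : Irr) : e <= f ->
  near_trivial z e l -> near_trivial z f l.
Proof. by move=> ef; apply: le_trans; rewrite lerD2l lerN2. Qed.

(** The witness is the sum of all [l] with [omega] within [e] of 1 in real part. The value of [e]
    puts the eigenvalues of [z] within [1 / (20 * m.+1)] of 1, hence within 1/20 after [m.+1]
    factors, where [near_trivial_half] applies. *)
Lemma tensor_power_obstruction k m t z (D : {set gT}) :
    let B : C := #|D|%:R in
    let e : C := (20 * m.+1%:R)^-1 ^+ 2 / (2 * k%:R) in
    (0 < k)%N -> z \in G -> z != 1%g -> (#|(z ^: G)%g| <= k)%N ->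
    {in G, forall g, walk C G z t g != 0 -> g \in D} ->
    B * (1 - e / 2) ^+ t <= 2^-1 ->
  exists V, [/\ 2^-1 <= B * plmeas (contained V)
              & plmeas (contained (tensor_iter V m)) <= 2^-1].
Proof.
move=> B e k0 Gz ntz Kk suppD Bt; pose S : pred Irr := near_trivial z e.
pose eps : C := (20 * m.+1%:R)^-1.
have K0 : (0 < #|(z ^: G)%g|)%N by apply/card_gt0P; exists z; apply: class_refl.
have eps0 : 0 <= eps by rewrite invr_ge0 mulr_ge0 ?ler0n.
have e01 : 0 <= e <= 1.
  rewrite divr_ge0 ?exprn_ge0 ?mulr_ge0 ?ler0n //=.
  rewrite ler_pdivrMr ?mulr_gt0 ?ltr0n // mul1r.
  apply: (@le_trans _ _ 1); last by rewrite -natrM ler1n muln_gt0.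
  by rewrite exprn_ile1 // invf_le1 -?natrM ?ltr0n ?ler1n ?muln_gt0.
exists (irr_dsum S); split.
  apply: (@le_trans _ _ (B * plmeas S)); last first.
    by rewrite ler_wpM2l ?ler0n //; apply: plmeas_le => l; apply: mult_irr_dsum.
  have := near_trivial_density Gz e01 suppD; rewrite -/B -/S mulrDr => le1.
  rewrite -(lerD2r 2^-1) (_ : 2^-1 + 2^-1 = 1); last by field.
  by apply: le_trans le1 _; rewrite lerD2l.
apply: le_trans (near_trivial_half _ Gz ntz); apply: plmeas_le => l.
have -> : 20^-1 = m.+1%:R * eps.
  by rewrite /eps invfM mulrCA divff ?mulr1 // pnatr_eq0.
apply: eigs_near_constituent => //; apply: eigs_near_iter.
apply: eigs_near_irr_dsum => l' Sl'; apply: near_trivial_eigs => //.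
apply: near_trivial_sub Sl'; rewrite ler_wpM2l ?exprn_ge0 //.
by rewrite lef_pV2 ?posrE ?mulr_gt0 ?ltr0n // ler_wpM2l ?ler0n // ler_nat.
Qed.

End TensorPowers.

(** * Exponential against polynomial growth *)

Lemma leq_exp_base (m n e : nat) : (m <= n -> m ^ e <= n ^ e)%N.
Proof. by case: e => // e; rewrite leq_exp2r. Qed.

Lemma exp2_dominates a k : exists s, (a * s.+1 ^ k <= 2 ^ s)%N.
Proof.
(* For [s = n * k.+1] one has [2 ^ s >= n.+1 ^ k.+1], and this [n] absorbs the remaining
   constants. *)
have [n En] : {n | n = a * k.+1 ^ k}%N by eexists.
exists (n * k.+1)%N; rewrite expnM.
apply: (@leq_trans (n.+1 ^ k.+1)); last by apply: leq_exp_base; exact: ltn_expl.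
apply: (@leq_trans (a * (n.+1 * k.+1) ^ k)).
  by rewrite leq_mul2l; apply/orP; right; apply: leq_exp_base; 
    rewrite mulSn -add1n leq_add2r.
by rewrite expnMn mulnCA -En expnSr leq_mul2l leqnSn orbT.
Qed.

(** Bernoulli gives [2 * p ^ p <= p.+1 ^ p], so [t = p * s] reduces to base 2; the factor [p ^ k]
    comes from [t.+1 <= p * s.+1]. *)
Lemma exp_dominates a k p : (0 < p)%N ->
  exists t, (a * t.+1 ^ k * p ^ t <= p.+1 ^ t)%N.
Proof.
move=> p0; have [s les] := exp2_dominates (a * p ^ k) k; exists (p * s)%N.
have bernoulli n : (p ^ n * (p + n) <= p * p.+1 ^ n)%N.
  elim: n => [|n IHn]; first by rewrite !expn0 mul1n addn0 muln1.
  rewrite [(p.+1 ^ _)%N]expnS mulnCA; apply: (@leq_trans (p.+1 * (p ^ n * (p + n)))).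
    rewrite expnS -mulnA mulnCA [leqRHS]mulnCA leq_mul2l; apply/orP; right.
    by rewrite addnS mulnS mulSn leq_add2r leq_addr.
  by rewrite leq_mul2l IHn orbT.
have base : (2 * p ^ p <= p.+1 ^ p)%N.
  by rewrite -(leq_pmul2l p0) mulnA [(p * 2)%N]muln2 -addnn mulnC.
rewrite !expnM; apply: (@leq_trans ((2 * p ^ p) ^ s)); last first.
  by case: s {les} => // s; rewrite leq_exp2r.
rewrite expnMn leq_mul2r; apply/orP; right; apply: leq_trans les.
rewrite -mulnA leq_mul2l -expnMn; apply/orP; right.
by apply: leq_exp_base; rewrite mulnS -add1n leq_add2r.
Qed.

(** * Small classes and small normal subgroups *)

Section SmallNormalSubgroups.

Variable gT : finGroupType.
Implicit Types (G N A : {group gT}) (s : seq gT) (x y z : gT).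

(** In an abelian group this contains the support of the walk after [t] steps, yet its size is
    polynomial in [t]. *)
Fixpoint inv_box s t : {set gT} :=
  if s is x :: s' then
    (fun (j : 'I_t.+1) h => x ^- j * h)%g @2: ([set: 'I_t.+1]%SET, inv_box s' t)
  else 1%g.

Lemma card_inv_box s t : (#|inv_box s t| <= t.+1 ^ size s)%N.
Proof.
elim: s => [|x s IHs] /=; first by rewrite cards1.
rewrite curry_imset2X; apply: leq_trans (leq_imset_card _ _) _.
by rewrite cardsX expnS cardsT card_ord leq_mul2l IHs orbT.
Qed.

Lemma inv_box_id s t : 1%g \in inv_box s t.
Proof.
elim: s => [|x s IHs] /=; first by rewrite group1.
by apply/imset2P; exists ord0 1%g; rewrite ?finset.in_setT //= expg0 invg1 mulg1.
Qed.

Lemma inv_boxS s t : inv_box s t \subset inv_box s t.+1.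
Proof.
elim: s => [|x s IHs] //=; apply/fintype.subsetP => _ /imset2P[j h _ sh ->].
apply/imset2P; exists (widen_ord (leqnSn _) j) h; rewrite ?finset.in_setT //.
exact: (fintype.subsetP IHs).
Qed.

(** Commutativity moves [y^-1] to the factor of [y], whose exponent goes up by one. *)
Lemma inv_box_mulV A s t y h : abelian A -> {subset s <= A} -> y \in s ->
  h \in inv_box s t -> (h * y^-1)%g \in inv_box s t.+1.
Proof.
move=> abA; elim: s h => [|x s IHs] //= h sA.
have Ax : x \in A by apply: sA; rewrite mem_head.
have {}sA : {subset s <= A} by move=> u su; apply: sA; rewrite inE su orbT.
have box_sub r : {subset inv_box s r <= A}.
  elim: s {IHs} sA => [|u s IHs] sA /= v; first by rewrite inE => /eqP->.
  case/imset2P=> j w _ sw ->; rewrite groupM ?groupV ?groupX //.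
    by apply: sA; rewrite mem_head.
  by apply: IHs => // u' su'; apply: sA; rewrite inE su' orbT.
rewrite inE => /orP[/eqP-> | sy] /imset2P[j w _ sw ->]; last first.
  apply/imset2P; exists (widen_ord (leqnSn _) j) (w * y^-1)%g; rewrite ?finset.in_setT //.
    exact: IHs.
  by rewrite mulgA.
apply/imset2P; exists (lift ord0 j) w; rewrite ?finset.in_setT //.
  by rewrite (fintype.subsetP (inv_boxS _ _)).
rewrite lift0 expgS invMg -!mulgA; congr (_ * _)%g.
have /centsP cAA := abA; apply: cAA; first exact: box_sub sw.
by rewrite groupV.
Qed.

Lemma walk_supp_normal (C : numClosedFieldType) G N z t g :
    (N <| G)%g -> z \in N -> g \in G -> walk C G z t g != 0 -> g \in N.
Proof.
move=> nNG Nz Gg; have Gz := fintype.subsetP (normal_sub nNG) z Nz.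
have KN x : x \in (z ^: G)%g -> x \in N.
  by case/imsetP=> h Gh ->; rewrite memJ_norm // (fintype.subsetP (normal_norm nNG)).
apply: (walk_supp (D := fun=> N : {set gT})) => // r x h Kx Nh.
by rewrite groupM // groupV KN.
Qed.

Lemma walk_supp_abelian (C : numClosedFieldType) G A z t g :
    (A <| G)%g -> abelian A -> z \in A -> g \in G -> walk C G z t g != 0 ->
  g \in inv_box (enum (z ^: G)%g) t.
Proof.
move=> nAG abA Az Gg; have Gz := fintype.subsetP (normal_sub nAG) z Az.
apply: (walk_supp (D := inv_box (enum (z ^: G)%g))) => //.
- exact: inv_box_id.
- exact: inv_boxS.
move=> r x h Kx; apply: inv_box_mulV abA _ _; last by rewrite mem_enum.
move=> y; rewrite mem_enum => /imsetP[u Gu ->].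
by rewrite memJ_norm // (fintype.subsetP (normal_norm nAG)).
Qed.

(** The walk stays in [N] in the first case. In the second, [z] is central in [N], so its class has
    at most [#|G : N|] elements and a box supports the walk. [B] bounds both supports, and [k.+1]
    keeps the class bound positive. *)
Lemma small_normal_obstruction (C : numClosedFieldType) G k m t :
    let B : C := (k.+1 * t.+1 ^ k.+1)%:R in
    let e : C := (20 * m.+1%:R)^-1 ^+ 2 / (2 * k.+1%:R) in
    B * (1 - e / 2) ^+ t <= 2^-1 ->
    (exists N, [/\ (N <| G)%g, N :!=: 1%g & (#|N| <= k)%N]) \/
    (exists N, [/\ (N <| G)%g, (#|G : N|%g <= k)%N & 'Z(N)%g != 1%g]) ->
  exists V : representation C G, [/\ 2^-1 <= B * plmeas (contained V)
              & plmeas (contained (tensor_iter V m)) <= 2^-1].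
Proof.
move=> B e Bt.
suff main z (D : {set gT}) : z \in G -> z != 1%g -> (#|(z ^: G)%g| <= k.+1)%N ->
    {in G, forall g, walk C G z t g != 0 -> g \in D} ->
    (#|D| <= k.+1 * t.+1 ^ k.+1)%N ->
  exists V : representation C G, [/\ 2^-1 <= B * plmeas (contained V)
              & plmeas (contained (tensor_iter V m)) <= 2^-1].
  case=> [] [N [nNG]].
    move=> ntN Nk; have [z Nz ntz] := trivgPn _ ntN.
    have Gz := fintype.subsetP (normal_sub nNG) z Nz.
    apply: (main z N) => //; first last.
    - by rewrite (leq_trans (leqW Nk)) // leq_pmulr // expn_gt0.
    - by move=> g Gg; apply: walk_supp_normal nNG Nz Gg.
    apply: leq_trans (leqW Nk); apply: subset_leq_card.
    apply/fintype.subsetP => _ /imsetP[h Gh ->].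
    by rewrite memJ_norm // (fintype.subsetP (normal_norm nNG)).
  move=> Nk ntZ; have [z Zz ntz] := trivgPn _ ntZ.
  have nZG : ('Z(N) <| G)%g by apply: gFnormal_trans nNG.
  have Gz := fintype.subsetP (normal_sub nZG) z Zz.
  have Kk : (#|(z ^: G)%g| <= k)%N.
    rewrite -index_cent1; apply: leq_trans Nk; apply: dvdn_leq => //; apply: indexgS.
    rewrite finset.subsetI (normal_sub nNG) sub_cent1.
    by case/finset.setIP: Zz.
  apply: (main z (inv_box (enum (z ^: G)%g) t)) => //.
  - exact: leqW.
  - by move=> g Gg; apply: walk_supp_abelian nZG (center_abelian N) Zz Gg.
  apply: leq_trans (card_inv_box _ _) _; rewrite -cardE.
  apply: (@leq_trans (t.+1 ^ k.+1)); last by rewrite leq_pmull.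
  by rewrite leq_pexp2l // leqW.
move=> Gz ntz Kk suppD DB.
have [|V [V1 V2]] := @tensor_power_obstruction _ _ _ k.+1 m _ _ _ isT Gz ntz Kk suppD.
  apply: le_trans Bt; rewrite ler_wpM2r ?ler_nat // exprn_ge0 // subr_ge0.
  rewrite ler_pdivrMr ?ltr0n // mul1r ler_pdivrMr ?mulr_gt0 ?ltr0n //.
  apply: (@le_trans _ _ 1); last by rewrite -!natrM ler1n !muln_gt0.
  by rewrite exprn_ile1 ?invr_ge0 -?natrM ?ler0n // invf_le1 ?ltr0n ?ler1n ?muln_gt0.
exists V; split=> //; apply: le_trans V1 _; rewrite ler_wpM2r ?plmeas_ge0 //.
by rewrite ler_nat.
Qed.

(** Centralizing one more element multiplies the index by at most [k]. *)
Lemma index_cent_le G s k :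
    {in s, forall x, (x \in G) && (#|(x ^: G)%g| <= k)%N} ->
  (#|G : 'C_G([set x in s]%SET)|%g <= k ^ size s)%N.
Proof.
elim: s => [|x s IHs] sk.
  have -> : [set x : gT in [::]]%SET = finset.set0 by apply/setP=> x; rewrite !inE.
  by rewrite (finset.setIidPl _) ?indexgg // centsC finset.sub0set.
have /andP[Gx Kx] := sk x (mem_head _ _).
have {}IHs : (#|G : 'C_G([set x in s]%SET)|%g <= k ^ size s)%N.
  by apply: IHs => y sy; apply: sk; rewrite inE sy orbT.
set H := ('C_G([set y in s]%SET))%G in IHs.
have -> : ('C_G([set y in x :: s]%SET) = 'C_H[x])%g.
  by rewrite set_cons centU cent_set1 finset.setIA finset.setIAC.
rewrite -(Lagrange_index (finset.subsetIl G _) (finset.subsetIl H _)) expnSr leq_mul //.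
rewrite index_cent1; apply: leq_trans Kx; apply: subset_leq_card.
by apply: imsetS; apply: finset.subsetIl.
Qed.

Lemma small_class_normal G (K : {set gT}) k :
    K \in classes G -> K != 1%g -> (#|K| <= k)%N ->
  (exists N, [/\ (N <| G)%g, N :!=: 1%g & (#|N| <= k ^ k)%N]) \/
  (exists N, [/\ (N <| G)%g, (#|G : N|%g <= k ^ k)%N & 'Z(N)%g != 1%g]).
Proof.
case/imsetP=> z Gz -> ntK Kk; set K' := (z ^: G)%g in ntK Kk *.
have sKG : K' \subset G by rewrite class_subG.
have nKG : G \subset 'N(K')%g := class_norm z G.
have nHG : (<<K'>> <| G)%g by rewrite /normal gen_subG sKG norms_gen.
have nCG : ('C_G(K') <| G)%g.
  by rewrite /normal finset.subsetIl normsI ?normG ?norms_cent.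
have K0 : (0 < #|K'|)%N by apply/card_gt0P; exists z; apply: class_refl.
have k0 : (0 < k)%N := leq_trans K0 Kk.
have Ck : (#|G : 'C_G(K')|%g <= k ^ k)%N.
  have -> : K' = [set x in enum K']%SET by apply/setP=> x; rewrite inE mem_enum.
  apply: (@leq_trans (k ^ size (enum K'))).
    apply: index_cent_le => x; rewrite mem_enum => K'x.
    by rewrite (fintype.subsetP sKG) // (class_eqP K'x).
  by rewrite -cardE leq_pexp2l.
have [tiHC | ntHC] := eqVneq (<<K'>> :&: 'C_G(K'))%g 1%g.
  left; exists <<K'>>%G; split=> //.
    apply: contra ntK => /= /eqP K1; have zK : z \in K' := class_refl G z.
    rewrite finset.eqEsubset finset.sub1set -{1}K1 subset_gen /=.
    by move: (mem_gen zK); rewrite K1 => /finset.set1P <-.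
  (* The product of the two subgroups lies in [G] and, the intersection being trivial, has the
     product of their orders as its size. *)
  apply: leq_trans Ck; rewrite -(leq_pmul2r (cardG_gt0 ('C_G(K'))%G)) /=.
  rewrite -TI_cardMg // mulnC Lagrange ?finset.subsetIl //.
  by rewrite subset_leq_card // mul_subG ?normal_sub.
right; exists ('C_G(K'))%G; split=> //.
(* The centralizer of [K'] also centralizes [<<K'>>], so the intersection is central in it. *)
apply: contra ntHC; rewrite -!subG1 => Z1; apply: fintype.subset_trans Z1.
rewrite finset.subsetI finset.subsetIr /=.
rewrite (fintype.subset_trans (finset.subsetIl _ _)) //.
by rewrite gen_subG centsC finset.subsetIr.
Qed.

End SmallNormalSubgroups.

(** * The equivalence *)

Local Open Scope complex_scope.

Section Plancherel.

Variables (R : realType) (gT : finGroupType) (G : {group gT}).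
Implicit Types V W : representation R[i] G.

Lemma plancherelE V : (plancherel V)%:C = plmeas (contained V).
Proof.
rewrite /plancherel /plmeas rmorph_sum /=; apply: eq_big => [l|l _].
  by apply/asboolP/idP => [/mult_gt0|lV]; last apply/mult_gt0.
by rewrite rmorphM fmorphV rmorphXn !rmorph_nat.
Qed.

Lemma contained_subrep V W : mx_irreducible W ->
  (forall l, contained V l) -> subrep W V.
Proof.
move=> /Irr_complete[l simWl] /(_ l)/mult_gt0[U [modU simlU]].
by exists U, modU; apply: mx_rsim_trans simWl simlU.
Qed.

Lemma contained_rdegree V l : contained V l -> (0 < rdegree V)%N.
Proof.
rewrite lt0n; apply: contraTneq => V0; rewrite /contained -eqn0Ngt.
have G0 : #|G|%:R != 0 :> R[i] by rewrite pnatr_eq0 -lt0n.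
rewrite -(eqr_nat R[i]) -(inj_eq (mulIf G0)) mul0r -mult_dot big1 // => g Gg.
by have := chi_norm V Gg; rewrite V0 normr_le0 => /eqP->; rewrite mul0r.
Qed.

Lemma plancherel_gt0_contained V : 0 < plancherel V -> exists l, contained V l.
Proof.
move=> V0; have [l lV|none] := pickP (contained V); first by exists l.
by move: V0; rewrite -ltcR plancherelE /plmeas big_pred0 // ltxx.
Qed.

Lemma triple_tensor_full (delta : R) (k : nat) V1 V2 V3 W :
    0 < delta -> 4 <= k%:R * (delta ^+ 3) ^+ 2 ->
    ~ (exists K : {set gT}, [/\ K \in classes G, K != 1%g & (#|K| <= k)%N]) ->
    delta <= plancherel V1 -> delta <= plancherel V2 -> delta <= plancherel V3 ->
  mx_irreducible W -> subrep W (tensor (tensor V1 V2) V3).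
Proof.
move=> d0 kd noK dV1 dV2 dV3 irrW; apply: contained_subrep => // l.
apply: mult_tensor3; apply: (@triple_nonzero _ _ _ _ _ _ delta%:C k).
- by rewrite ltcR.
- by rewrite -plancherelE lecR.
- by rewrite -plancherelE lecR.
- by rewrite -plancherelE lecR.
- by move: kd; rewrite -lecR rmorphM !rmorphXn !rmorph_nat.
move=> g Gg ntg; rewrite leqNgt; apply/negP => lt_gk; case: noK.
exists (g ^: G)%g; split; [exact: imset_f | | exact: ltnW].
apply: contra ntg => /eqP g1; have := class_refl G g.
by rewrite g1 => /finset.set1P ->.
Qed.

(** [tensor_exp] associates to the right, but equal characters have equal multiplicities. Positive
    measure makes [V] nonzero, as required for adding further factors. *)
Lemma triple_power_full m V : 0 < plancherel V ->
    (forall W, mx_irreducible W -> subrep W (tensor (tensor V V) V)) ->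
  plancherel (tensor_exp V m.+3) = 1.
Proof.
move=> /plancherel_gt0_contained[l0 /contained_rdegree V0] full.
apply: complexI; rewrite plancherelE rmorph1 -(plmeasT R[i] G).
rewrite /tensor_exp iteropS; apply: eq_bigl => l.
transitivity true => //; apply: (@contained_iter_full _ _ _ V m) => // {}l.
rewrite /contained (@mult_eq _ _ _ _ (tensor (tensor V V) V)).
  by apply/mult_gt0; apply: full; apply: irr_rep_irr.
by move=> g Gg; rewrite !chi_prod mulrA.
Qed.

End Plancherel.

Lemma small_normal_power (R : realType) (k m : nat) : exists2 delta : R, 0 < delta &
  forall (gT : finGroupType) (G : {group gT}),
    (forall V : representation R[i] G,
      delta <= plancherel V -> 2^-1 < plancherel (tensor_exp V m.+1)) ->
    ~ (exists N : {group gT}, [/\ (N <| G)%g, N :!=: 1%g & (#|N| <= k)%N]) /\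
    ~ (exists N : {group gT},
         [/\ (N <| G)%g, (#|G : N|%g <= k)%N & 'Z(N)%g != 1%g]).
Proof.
(* Chosen so that [1 - e / 2 = p / p.+1] for the [e] of [small_normal_obstruction]. *)
pose p := ((20 * m.+1) ^ 2 * (4 * k.+1)).-1.
have Ep : p.+1 = ((20 * m.+1) ^ 2 * (4 * k.+1))%N.
  by rewrite prednK // muln_gt0 expn_gt0 muln_gt0.
have p0 : (0 < p)%N.
  by rewrite -ltnS Ep (@leq_trans (20 ^ 2 * 4)) // leq_mul ?leq_exp_base ?leq_pmulr.
have [t le_t] := exp_dominates (2 * k.+1) k.+1 p0.
pose b := (k.+1 * t.+1 ^ k.+1)%N; have b0 : (0 < b)%N by rewrite muln_gt0 expn_gt0.
(* Depends on [k] and [m] alone, hence uniform over all groups. *)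
exists (2 * b%:R)^-1; first by rewrite invr_gt0 mulr_gt0 ?ltr0n.
move=> gT G expG.
have B_le : b%:R * (1 - (20 * m.+1%:R)^-1 ^+ 2 / (2 * k.+1%:R) / 2) ^+ t <= 2^-1 :> R[i].
  have q0 : 0 < p.+1%:R :> R[i] by rewrite ltr0n.
  have -> : 1 - (20 * m.+1%:R)^-1 ^+ 2 / (2 * k.+1%:R) / 2 = p%:R / p.+1%:R :> R[i].
    apply: (mulIf (lt0r_neq0 q0)); rewrite divfK ?lt0r_neq0 //.
    rewrite mulrBl mul1r -natr1 -[RHS]addr0 -addrA; congr (_ + _).
    apply/eqP; rewrite subr_eq0 natr1 Ep natrM natrX !natrM; apply/eqP.
    by field; rewrite !nat1r !pnatr_eq0.
  rewrite expr_div_n mulrA ler_pdivrMr ?exprn_gt0 // [leRHS]mulrC ler_pdivlMr ?ltr0n //.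
  by rewrite -!natrX -!natrM ler_nat mulnC !mulnA.
suff noN : ~ ((exists N : {group gT}, [/\ (N <| G)%g, N :!=: 1%g & (#|N| <= k)%N]) \/
    (exists N : {group gT}, [/\ (N <| G)%g, (#|G : N|%g <= k)%N & 'Z(N)%g != 1%g])).
  by split=> N; apply: noN; [left | right].
move=> /(small_normal_obstruction B_le)[V []].
rewrite -!plancherelE => V1 V2.
have {}V1 : 2^-1 <= b%:R * plancherel V.
  by move: V1; rewrite -lecR rmorphM fmorphV !rmorph_nat.
have {}V2 : plancherel (tensor_exp V m.+1) <= 2^-1.
  by move: V2; rewrite -lecR fmorphV rmorph_nat /tensor_exp iteropS.
have /expG : (2 * b%:R)^-1 <= plancherel V.
  by rewrite invfM ler_pdivrMr ?ltr0n // mulrC.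
by rewrite ltNge V2.
Qed.

Theorem theorem1p2 (R : realType) (gT : nat -> finGroupType)
    (G : forall n, {group gT n}) (m : nat) :
  (fun n => #|G n|) @ \oo --> \oo ->
  (3 <= m)%N ->
  [<->
    forall k : nat, \forall n \near \oo,
      ~ (exists K : {set gT n},
           [/\ K \in classes (G n), K != 1%g & (#|K| <= k)%N]);
    forall delta : R, 0 < delta -> \forall n \near \oo,
      forall V1 V2 V3 : representation R[i] (G n),
        delta <= plancherel V1 -> delta <= plancherel V2 ->
        delta <= plancherel V3 ->
        forall W : representation R[i] (G n), mx_irreducible W ->
          subrep W (tensor (tensor V1 V2) V3);
    forall delta : R, 0 < delta -> \forall n \near \oo,
      forall V : representation R[i] (G n),
        delta <= plancherel V -> 2^-1 < plancherel (tensor_exp V m);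
    forall k : nat, \forall n \near \oo,
      ~ (exists N : {group gT n},
           [/\ (N <| G n)%g, N :!=: 1%g & (#|N| <= k)%N]) /\
      ~ (exists N : {group gT n},
           [/\ (N <| G n)%g, (#|G n : N|%g <= k)%N & 'Z(N)%g != 1%g])].
Proof.
move=> _ m3; have -> : m = (m - 3).+3 by rewrite -addn3 subnK.
move: (m - 3)%N => {m3}m; tfae.
- move=> P1 delta d0.
  (* The class size needed in [triple_tensor_full] is [4 / delta^6]. *)
  have /archi_boundP lt_k : 0 <= 4 / (delta ^+ 3) ^+ 2.
    by rewrite divr_ge0 ?ler0n // !exprn_ge0 // ltW.
  set k := Num.bound _ in lt_k; apply: filterS (P1 k) => n noK V1 V2 V3.
  move=> dV1 dV2 dV3 W irrW; apply: (triple_tensor_full d0 _ noK _ _ _ irrW) => //.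
  by rewrite -ler_pdivrMr ?ltW // !exprn_gt0.
- move=> P2 delta d0; apply: filterS (P2 delta d0) => n full V dV.
  rewrite triple_power_full; first by rewrite invf_lt1 ?ltr0n ?ltr1n.
    exact: lt_le_trans dV.
  by move=> W; apply: full.
- move=> P3 k; have [delta d0 noN] := small_normal_power R k m.+2.
  by apply: filterS (P3 delta d0) => n; apply: noN.
(* [k ^ k] bounds the index of the centralizer of a class of size at most [k]. *)
- move=> P4 k; apply: filterS (P4 (k ^ k)%N) => n [noN noC] [K [clK ntK Kk]].
  by case: (small_class_normal clK ntK Kk).
Qed.
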